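(* Let $a\in(0,1)$, $\varepsilon_0,M>0$, $N\ge0$ and $\gamma_\alpha\in\mu(a,\varepsilon_0,M,N)$. For integers $n\ge1$ let $C_n$ be the number determined by $\Lambda_\alpha(e^{in\theta})=C_n\,|n|\,e^{in\theta}$. Assume that there is no strictly increasing sequence of positive integers $\{n_k\}_{k=1}^\infty$ such that $C_{n_k}=\alpha_0$ for all $k$. Then the following formulas hold: (i) $\alpha_0=\lim_{n\to\infty}C_n$. (ii) $a^{-2}=\displaystyle\lim_{n\to\infty}\frac{C_n-\alpha_0}{C_{n+1}-\alpha_0}$. (iii) $\alpha_1=\alpha_0D$, where $$D=\frac{\displaystyle\lim_{n\to\infty}\frac{C_n-\alpha_0}{2a^{2|n|}\alpha_0}+1}{1-\displaystyle\lim_{n\to\infty}\frac{C_n-\alpha_0}{2a^{2|n|}\alpha_0}}.$$ (iv) $a\alpha_2=\alpha_1E$, where $$E=\lim_{n\to\infty}(2|n|+1)\left[\frac{\alpha_0\left(2\alpha_0a^{2|n|}+(C_n-\alpha_0)(1+a^{2|n|})\right)}{\alpha_1\left(2\alpha_0a^{2|n|}-(C_n-\alpha_0)(1-a^{2|n|})\right)}-1\right].$$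
   Context: For $\alpha=(\alpha_0,\alpha_1,\alpha_2)$ define on the unit disc $B=B(0,1)\subset\mathbb{R}^2$ the radial conductivity, with $r=|x|$, $$\gamma_\alpha(x)=\begin{cases}\alpha_1+\alpha_2(a-r) & \text{if } 0\le r<a,\\ \alpha_0 & \text{if } a\le r<1.\end{cases}$$ $\mu(a,\varepsilon_0,M,N)$ is the set of all such $\gamma_\alpha$ with $\varepsilon_0\le\alpha_0,\alpha_1\le M$ and $0\le\alpha_2\le N$. For $f\in H^{1/2}(\partial B)$ let $u\in H^1(B)$ be the unique weak solution of $\nabla\cdot(\gamma_\alpha\nabla u)=0$ in $B$, $u=f$ on $\partial B$. The Dirichlet-to-Neumann map is $\Lambda_\alpha:H^{1/2}(\partial B)\to H^{-1/2}(\partial B)$, $\Lambda_\alpha f=\gamma_\alpha\,\partial_\nu u|_{\partial B}$, where $\nu$ is the exterior unit normal. Since $\gamma_\alpha$ is radial, each $e^{in\theta}$ ($\theta$ the angular variable on $\partial B$) is an eigenfunction of $\Lambda_\alpha$, so $C_n=\Lambda_\alpha(e^{in\theta})/(|n|e^{in\theta})$ is a well-defined number. *)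

(* Defs.v *)
From HB Require Import structures.
From mathcomp Require Import all_boot all_order all_algebra.
From mathcomp Require Import all_classical all_reals all_analysis.
From mathcomp.real_closed Require Export complex.
Set Implicit Arguments.
Unset Strict Implicit.
Unset Printing Implicit Defensive.
Import Order.TTheory GRing.Theory Num.Theory.
Import numFieldNormedType.Exports.
Local Open Scope classical_set_scope.
Local Open Scope ring_scope.
Local Open Scope complex_scope.

Section Disc.
Context {R : realType}.

Definition leb2 := ((@lebesgue_measure R) \x (@lebesgue_measure R))%E.

(* The norm the library puts on [R * R] is the max norm, hence this one. *)
Definition enorm (x : R * R) : R := Num.sqrt (x.1 ^+ 2 + x.2 ^+ 2).

Definition disc : set (R * R) := [set x | enorm x < 1].

(* Functions on the unit circle are functions of the angle in [0, 2 pi]. *)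
Definition angles : set R := `[0, 2 * pi]%classic.

Definition on_circle (u : R * R -> R) (t : R) : R := u (cos t, sin t).

Definition dot (v w : R * R) : R := v.1 * w.1 + v.2 * w.2.

Definition d1 (u : R * R -> R) (x : R * R) : R := 'D_((1, 0) : R * R) u x.
Definition d2 (u : R * R -> R) (x : R * R) : R := 'D_((0, 1) : R * R) u x.
Definition grad (u : R * R -> R) (x : R * R) : R * R := (d1 u x, d2 u x).

Fixpoint Ck (k : nat) (u : R * R -> R) : Prop :=
  if k is k'.+1 then
    [/\ continuous u,
        forall x, derivable u x ((1, 0) : R * R) /\
                  derivable u x ((0, 1) : R * R),
        Ck k' (d1 u) & Ck k' (d2 u)]
  else continuous u.

Definition smooth (u : R * R -> R) : Prop := forall k, Ck k u.

Definition test_function (phi : R * R -> R) : Prop :=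
  smooth phi /\ exists K : set (R * R),
    [/\ compact K, K `<=` disc & forall x, ~ K x -> phi x = 0].

Definition L2 d (T : measurableType d) (mu : set T -> \bar R) (D : set T)
    (f : T -> R) : Prop :=
  measurable_fun D f /\ (\int[mu]_(x in D) ((f x) ^+ 2)%:E < +oo)%E.

Definition L2_cvg d (T : measurableType d) (mu : set T -> \bar R) (D : set T)
    (fk : nat -> T -> R) (f : T -> R) : Prop :=
  (\int[mu]_(x in D) ((fk k x - f x) ^+ 2)%:E)%E @[k --> \oo] --> 0%E.

(* [H1 u g]: u is in H^1(disc) and g is its weak gradient. *)
Definition H1 (u : R * R -> R) (g : R * R -> R * R) : Prop :=
  [/\ L2 leb2 disc u, L2 leb2 disc (fst \o g), L2 leb2 disc (snd \o g) &
      forall phi, test_function phi ->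
        (\int[leb2]_(x in disc) (u x * d1 phi x))%R =
          - (\int[leb2]_(x in disc) ((g x).1 * phi x))%R /\
        (\int[leb2]_(x in disc) (u x * d2 phi x))%R =
          - (\int[leb2]_(x in disc) ((g x).2 * phi x))%R].

(* The trace H^1(disc) -> L^2(circle) is the continuous extension of the
   restriction to the circle of the functions that are C^1 on the closed
   disc; the latter are taken as restrictions of C^1 functions on the plane. *)
Definition H1_trace (u : R * R -> R) (g : R * R -> R * R) (f : R -> R) : Prop :=
  [/\ H1 u g, L2 lebesgue_measure angles f &
      exists uk : nat -> R * R -> R,
        [/\ forall k, Ck 1 (uk k),
            L2_cvg leb2 disc uk u,
            L2_cvg leb2 disc (fun k => d1 (uk k)) (fst \o g),
            L2_cvg leb2 disc (fun k => d2 (uk k)) (snd \o g) &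
            L2_cvg lebesgue_measure angles (fun k => on_circle (uk k)) f]].

(* H^{1/2}(circle) is the range of the trace. *)
Definition H12 (f : R -> R) : Prop := exists u g, H1_trace u g f.

Definition dirichlet_form (gam : R * R -> R) (g h : R * R -> R * R) : R :=
  (\int[leb2]_(x in disc) (gam x * dot (g x) (h x)))%R.

(* u, with weak gradient g, is a weak solution of div (gam grad u) = 0 in the
   disc and u = f on the circle. *)
Definition dirichlet_solution (gam : R * R -> R) (f : R -> R)
    (u : R * R -> R) (g : R * R -> R * R) : Prop :=
  H1_trace u g f /\
  forall phi, test_function phi -> dirichlet_form gam g (grad phi) = 0.

(* Elements of H^{-1/2}(circle) are functionals on H^{1/2}(circle).  The
   conormal derivative gam d_nu u of a solution u is defined, through Green's
   formula, by <gam d_nu u, h> = int_disc gam grad u . grad v for every v in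
   H^1(disc) with trace h.  [is_DN gam f L] says Lambda_gam f = L. *)
Definition is_DN (gam : R * R -> R) (f : R -> R) (L : (R -> R) -> R) : Prop :=
  exists u g, dirichlet_solution gam f u g /\
    forall v gv h, H1_trace v gv h -> L h = dirichlet_form gam g gv.

(* The complex-linear extension of Lambda_gam to complex-valued data. *)
Definition is_DNC (gam : R * R -> R) (f : R -> R[i]) (L : (R -> R) -> R[i]) :
    Prop :=
  exists Lre Lim : (R -> R) -> R,
    [/\ is_DN gam (fun t => complex.Re (f t)) Lre,
        is_DN gam (fun t => complex.Im (f t)) Lim &
        forall h, H12 h -> L h = Lre h +i* Lim h].

(* The embedding of L^2(circle) into H^{-1/2}(circle). *)
Definition functional_of (f : R -> R[i]) (h : R -> R) : R[i] :=
  (\int[lebesgue_measure]_(t in angles) (complex.Re (f t) * h t))%R +i*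
  (\int[lebesgue_measure]_(t in angles) (complex.Im (f t) * h t))%R.

Definition expi (n : nat) (t : R) : R[i] :=
  cos (n%:R * t) +i* sin (n%:R * t).

(* Only the values for [enorm x < 1] matter. *)
Definition conductivity (a alpha0 alpha1 alpha2 : R) (x : R * R) : R :=
  if enorm x < a then alpha1 + alpha2 * (a - enorm x) else alpha0.

Definition in_mu (eps0 M N alpha0 alpha1 alpha2 : R) : Prop :=
  [/\ eps0 <= alpha0 <= M, eps0 <= alpha1 <= M & 0 <= alpha2 <= N].

End Disc.

(* Main.v *)
(** The numbers [C n] are squeezed between explicit bounds by duality; the
    radial differential equation is never solved.

    Testing the definition of [Lambda] on the two solutions with data [cos nt]
    and [sin nt] shows that [C n] is real and that both have energy
    [pi n (C n)].  Dirichlet's principle, with the trial functions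
    [eta(|z|^2) z^n], bounds [C n] from above; Thomson's principle, with the
    divergence-free fields [rot (eta(|z|^2) z^n)], bounds it from below.  Using
    real and imaginary parts together makes all the densities radial.  The right
    profile is [eta(s) = A + B s^-n] for [s > a^2], constant for [s < a^2]: exact
    outside, and accurate to the order [n^-2] inside.  Writing [beta_n] for the
    fraction in (iv), [k = a alpha2 / alpha1] and [q = alpha1 / alpha0], one gets
      [k - k^2 / (n+1) <= (2n+1) (beta_n - 1) <= k]
    and, exactly,
      [C n - alpha0 = 2 alpha0 a^(2n) (q beta_n - 1) /
                      ((1 + q beta_n) + a^(2n) (1 - q beta_n))].
    All four limits follow.  The hypothesis on subsequences only excludes
    [alpha1 = alpha0] with [alpha2 = 0], where [C n = alpha0] for all [n]. *)

Require Import Defs.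
From mathcomp Require Import all_boot all_order all_algebra.
From mathcomp Require Import all_classical all_reals all_analysis.
From mathcomp Require Import measurable_realfun.
From mathcomp.real_closed Require Import complex.
From mathcomp Require Import ring lra.
Import Order.TTheory GRing.Theory Num.Theory.
Import numFieldNormedType.Exports.
Local Open Scope classical_set_scope.
Local Open Scope ring_scope.
Local Open Scope complex_scope.

(** The optimal profile has a kink at [s = a^2], while the trace is defined through [C^1] functions
    and Green's formula is applied to rotated gradients, which must be [C^1] themselves. The
    inequalities are therefore proved for [C^2] profiles and carried to the kinked one by dominated
    convergence. Inside, a constant profile leaves a multiple of [z^n], whose energy density is
    proportional to [s^(n-1)] and concentrates at the interface as [n] grows. The mean of [a - r]
    under it is exactly [a / (2n+1)]: hence the factor [2n+1] in (iv), and an upper bound [k]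
    without error term. Thomson's principle involves [1 / gamma], which is not polynomial in [r]; a
    quadratic majorant keeps the integrals explicit, and the mean [a^2 / ((2n+1)(n+1))] of
    [(a - r)^2] produces the error [k^2 / (n+1)]. The number [beta_n] is the conductivity, relative
    to [alpha1], of a homogeneous core with the same eigenvalue. This is why the bounds bear on it
    and why [C n] is an explicit homographic function of it. *)

Lemma open_measurable2 (R : realType) (U : set (R * R)) :
  open U -> measurable U.
Proof.
move=> oU.
(* Max-norm balls with rational centre and radius are rectangles, hence measurable, and there are
   countably many; those contained in [U] cover it. *)
pose V (q : rat * rat * rat) : set (R * R) :=
  ball (ratr q.1.1 : R) (ratr q.2) `*` ball (ratr q.1.2 : R) (ratr q.2).
pose W q : set (R * R) := if `[< V q `<=` U >] then V q else set0.
have -> : U = \bigcup_q W q.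
  apply/seteqP; split=> [x Ux|x [q _]]; last first.
    by rewrite /W; case: ifPn => // /asboolP /[apply].
  have /nbhs_ballP[e /= e0 xeU] : nbhs x U by exact: open_nbhs_nbhs.
  have e20 : 0 < e / 2 by rewrite divr_gt0.
  have [r /=] := rat_in_itvoo e20; rewrite in_itv/= => /andP[r0 re].
  have /rat_in_itvoo[q1 /=] : x.1 - ratr r < x.1 + ratr r by lra.
  rewrite in_itv/= => /andP[q1l q1r].
  have /rat_in_itvoo[q2 /=] : x.2 - ratr r < x.2 + ratr r by lra.
  rewrite in_itv/= => /andP[q2l q2r].
  exists (q1, q2, r) => //; rewrite /W; case: ifPn => [_|/asboolP].
    by split; rewrite /V/= /ball/= ltr_norml; lra.
  move=> /= []; move=> y [/=]; rewrite /ball/= !ltr_norml => y1 y2; apply: xeU.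
  by split; rewrite /ball/= ltr_norml; lra.
apply: countable_bigcupT_measurable; first exact: countableP.
move=> q; rewrite /W; case: ifPn => // _.
by apply: measurableX; rewrite ball_itv; exact: measurable_itv.
Qed.

Lemma continuous_measurable_fun2 (R : realType) (f : R * R -> R) D :
  continuous f -> measurable_fun D f.
Proof.
move=> /continuousP cf; apply: measurable_funTS.
apply: (measurability _ (RGenOpens.measurableE R)).
move=> _ [_ [a [b ->] <-]]; rewrite setTI.
apply: open_measurable2; apply: cf; exact: interval_open.
Qed.

(** * Calculus of C^1 functions on the plane *)

Section C1_functions.
Context {R : realType}.
Implicit Types (u v w : R * R -> R) (x : R * R) (h : R -> R).

(** Both difference quotients are the same function of [h]. This brings the one-variable chain rule
    and fundamental theorem of calculus to bear on partial derivatives. *)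
Lemma is_derive_line1 u x d :
  is_derive x ((1, 0) : R * R) u d <-> is_derive x.1 1 (fun t => u (t, x.2)) d.
Proof.
have E : (fun h : R => h^-1 *: (u (h *: ((1, 0) : R * R) + x) - u x)) =
         (fun h : R => h^-1 *: (u (h *: 1 + x.1, x.2) - u (x.1, x.2))).
  apply/funext => h; rewrite -surjective_pairing; congr (_ *: (u _ - _)).
  case: x => a b /=; transitivity (h *: 1 + a, h *: 0 + b) => //.
  by rewrite scaler0 add0r.
by split=> -[]; rewrite /derivable /derive ?E => d1 d2;
  apply: DeriveDef; rewrite /derivable /derive ?E.
Qed.

Lemma is_derive_line2 u x d :
  is_derive x ((0, 1) : R * R) u d <-> is_derive x.2 1 (fun t => u (x.1, t)) d.
Proof.
have E : (fun h : R => h^-1 *: (u (h *: ((0, 1) : R * R) + x) - u x)) =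
         (fun h : R => h^-1 *: (u (x.1, h *: 1 + x.2) - u (x.1, x.2))).
  apply/funext => h; rewrite -surjective_pairing; congr (_ *: (u _ - _)).
  case: x => a b /=; transitivity (h *: 0 + a, h *: 1 + b) => //.
  by rewrite scaler0 add0r.
by split=> -[]; rewrite /derivable /derive ?E => d1 d2;
  apply: DeriveDef; rewrite /derivable /derive ?E.
Qed.

(** The derivatives are explicit functions rather than [d1 u] and [d2 u]: sums, products and
    compositions then compute them. *)
Definition C1_with u u1 u2 : Prop :=
  [/\ continuous u, forall x, is_derive x ((1, 0) : R * R) u (u1 x),
      forall x, is_derive x ((0, 1) : R * R) u (u2 x),
      continuous u1 & continuous u2].

Lemma C1_withP u u1 u2 :
  C1_with u u1 u2 -> [/\ Ck 1 u, d1 u = u1 & d2 u = u2].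
Proof.
move=> [cu u1P u2P cu1 cu2].
have e1 : d1 u = u1 by apply/funext => x; have [] := u1P x.
have e2 : d2 u = u2 by apply/funext => x; have [] := u2P x.
split=> //; split=> //; rewrite ?e1 ?e2//.
Qed.

Lemma Ck1_C1_with u : Ck 1 u -> C1_with u (d1 u) (d2 u).
Proof.
move=> [cu du c1 c2]; split; [exact: cu| | |exact: c1|exact: c2] => x.
  by apply: DeriveDef; [exact: (du x).1|reflexivity].
by apply: DeriveDef; [exact: (du x).2|reflexivity].
Qed.

Lemma C1_with_cst (c : R) : C1_with (fun=> c) (fun=> 0) (fun=> 0).
Proof.
by split=> [|x|x||]; try exact: cst_continuous; exact: is_derive_cst.
Qed.

Lemma C1_with_fst : C1_with fst (fun=> 1) (fun=> 0).
Proof.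
split=> [|x|x||]; try exact: cst_continuous; first by move=> x; exact: cvg_fst.
  by apply/is_derive_line1; exact: is_derive_id.
by apply/is_derive_line2; exact: is_derive_cst.
Qed.

Lemma C1_with_snd : C1_with snd (fun=> 0) (fun=> 1).
Proof.
split=> [|x|x||]; try exact: cst_continuous; first by move=> x; exact: cvg_snd.
  by apply/is_derive_line1; exact: is_derive_cst.
by apply/is_derive_line2; exact: is_derive_id.
Qed.

Lemma C1_withD u u1 u2 v v1 v2 : C1_with u u1 u2 -> C1_with v v1 v2 ->
  C1_with (fun x => u x + v x) (fun x => u1 x + v1 x) (fun x => u2 x + v2 x).
Proof.
move=> [cu hu1 hu2 cu1 cu2] [cv hv1 hv2 cv1 cv2].
split=> [x|x|x|x|x]; try exact: is_deriveD; apply: cvgD;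
  by [exact: cu|exact: cv|exact: cu1|exact: cv1|exact: cu2|exact: cv2].
Qed.

Lemma C1_withM u u1 u2 v v1 v2 : C1_with u u1 u2 -> C1_with v v1 v2 ->
  C1_with (fun x => u x * v x) (fun x => u1 x * v x + u x * v1 x)
    (fun x => u2 x * v x + u x * v2 x).
Proof.
move=> [cu hu1 hu2 cu1 cu2] [cv hv1 hv2 cv1 cv2]; split=> [x|x|x|x|x].
- by apply: cvgM; [exact: cu|exact: cv].
- by apply: is_derive_eq; rewrite /GRing.scale/= addrC mulrC.
- by apply: is_derive_eq; rewrite /GRing.scale/= addrC mulrC.
- by apply: cvgD; apply: cvgM;
    [exact: cu1|exact: cv|exact: cu|exact: cv1].
- by apply: cvgD; apply: cvgM;
    [exact: cu2|exact: cv|exact: cu|exact: cv2].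
Qed.

Lemma C1_with_comp h h' u u1 u2 :
  (forall t : R, is_derive t 1 h (h' t)) -> continuous h' -> C1_with u u1 u2 ->
  C1_with (fun x => h (u x)) (fun x => h' (u x) * u1 x)
    (fun x => h' (u x) * u2 x).
Proof.
move=> hh ch' [cu hu1 hu2 cu1 cu2].
have ch : continuous h.
  move=> t; apply: differentiable_continuous; apply/derivable1_diffP.
  by case: (hh t).
split=> [x|x|x|x|x].
- by apply: continuous_comp; [exact: cu|exact: ch].
- have /is_derive_line1 u1x := hu1 x.
  apply/is_derive_line1.
  have := @is_derive1_comp _ h (fun t => u (t, x.2)) x.1 (h' (u x)) (u1 x).
  by rewrite -surjective_pairing mulrC; apply; exact: hh.
- have /is_derive_line2 u1x := hu2 x.
  apply/is_derive_line2.
  have := @is_derive1_comp _ h (fun t => u (x.1, t)) x.2 (h' (u x)) (u2 x).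
  by rewrite -surjective_pairing mulrC; apply; exact: hh.
- by apply: cvgM; [apply: continuous_comp; [exact: cu|exact: ch']|exact: cu1].
- by apply: cvgM; [apply: continuous_comp; [exact: cu|exact: ch']|exact: cu2].
Qed.

End C1_functions.

(** * Integrals over intervals *)

Section interval_integrals.
Context {R : realType}.
Notation mu := (@lebesgue_measure R).
Implicit Types (h F f : R -> R) (a b c : R).

Lemma continuous_integrable_itv h a b : continuous h ->
  mu.-integrable `[a, b] (EFin \o h).
Proof.
move=> ch; apply: continuous_compact_integrable; first exact: segment_compact.
exact: continuous_subspaceT.
Qed.

Lemma EFin_Rintegral_itv h a b : continuous h ->
  (\int[mu]_(t in `[a, b]) (h t)%:E = (\int[mu]_(t in `[a, b]) h t)%R%:E)%E.
Proof.
move=> ch; rewrite /Rintegral fineK//; apply: integrable_fin_num => //.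
exact: continuous_integrable_itv.
Qed.

Lemma integrable_Rintegral_itv_cat h a b c :
  mu.-integrable `[a, c] (EFin \o h) -> a <= b -> b <= c ->
  \int[mu]_(t in `[a, b]) h t + \int[mu]_(t in `[b, c]) h t =
  \int[mu]_(t in `[a, c]) h t.
Proof.
move=> ih ab bc.
have ibc : mu.-integrable `]b, c] (EFin \o h).
  by apply: integrableS ih => //; apply: subset_itvr; rewrite bnd_simp.
rewrite -(@Rintegral_itv_obnd_cbnd _ b (BRight c) h ibc).
rewrite -(@Rintegral_itvB _ h (BLeft a) (BRight c)).
- by rewrite addrC subrK.
- exact: ih.
- by rewrite bnd_simp.
- by rewrite bnd_simp.
Qed.

Lemma Rintegral_itv_cat h a b c : continuous h -> a <= b -> b <= c ->
  \int[mu]_(t in `[a, b]) h t + \int[mu]_(t in `[b, c]) h t =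
  \int[mu]_(t in `[a, c]) h t.
Proof.
move=> ch; apply: integrable_Rintegral_itv_cat.
exact: continuous_integrable_itv.
Qed.

(** End points are null, and [f] inherits measurability from [h] on the open interval. Piecewise
    densities are replaced in this way by their formulas, whatever their values at the interface. *)
Lemma eq_Rintegral_itvoo h f a b : measurable_fun setT h ->
  (forall t, a < t < b -> h t = f t) ->
  \int[mu]_(t in `[a, b]) h t = \int[mu]_(t in `[a, b]) f t.
Proof.
move=> mh hf; rewrite /Rintegral.
have mh' : measurable_fun (`]a, b[%classic : set R) (EFin \o h).
  by apply/measurable_EFinP; exact: measurable_funTS.
have mf' : measurable_fun (`]a, b[%classic : set R) (EFin \o f).
  apply: eq_measurable_fun mh' => t; rewrite inE/= in_itv/= => tab.
  by rewrite hf.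
rewrite (integral_itv_bndoo true false mh') (integral_itv_bndoo true false mf').
by congr fine; apply: eq_integral => t; rewrite inE/= in_itv/= => /hf ->.
Qed.

Lemma derivable_continuous F f : (forall t : R, is_derive t 1 F (f t)) ->
  continuous F.
Proof.
by move=> dF t; apply: differentiable_continuous; apply/derivable1_diffP.
Qed.

Lemma integral_FTC2 f F a b : a <= b -> continuous f ->
  (forall t : R, is_derive t 1 F (f t)) ->
  (\int[mu]_(t in `[a, b]) (f t)%:E = (F b - F a)%:E)%E.
Proof.
rewrite le_eqVlt => /predU1P[-> _ _|ab cf dF].
  by rewrite set_itv1 integral_set1 subrr.
have cF := derivable_continuous _ _ dF.
rewrite (continuous_FTC2 (F := F))//.
- exact: continuous_subspaceT.
- split; first by move=> t _; have [] := dF t.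
  + by apply: cvg_at_right_filter; exact: cF.
  + by apply: cvg_at_left_filter; exact: cF.
- by move=> t _; rewrite derive1E; have [] := dF t.
Qed.

Lemma Rintegral_FTC2 f F a b : a <= b -> continuous f ->
  (forall t : R, is_derive t 1 F (f t)) ->
  \int[mu]_(t in `[a, b]) f t = F b - F a.
Proof. by move=> ab cf dF; rewrite /Rintegral (integral_FTC2 f F). Qed.

Lemma Rintegral_reflect h a b c : continuous h -> a <= b ->
  \int[mu]_(t in `[a, b]) h (c - t) = \int[mu]_(t in `[c - b, c - a]) h t.
Proof.
move=> ch ab; rewrite /Rintegral; congr fine.
have dF (t : R) : is_derive t 1 (fun t => c - t) (- 1).
  by apply: is_derive_eq; rewrite add0r mul1r.
have dF1 : derive1 (fun t : R => c - t) = cst (- 1).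
  by apply/funext => t; rewrite derive1E; have [] := dF t.
have cF := derivable_continuous _ _ dF.
rewrite (@integration_by_substitution_decreasing _ (fun t => c - t) h a b)//.
- by apply: eq_integral => t _; rewrite /= dF1 /= !fctE opprK mulr1.
- by move=> x y _ _ yx; rewrite ltrD2l ltrN2.
- by rewrite dF1 => t _; exact: cvg_cst.
- by rewrite dF1; exact: is_cvg_cst.
- by rewrite dF1; exact: is_cvg_cst.
- split; first by move=> t _; have [] := dF t.
  + by apply: cvg_at_right_filter; exact: cF.
  + by apply: cvg_at_left_filter; exact: cF.
- exact: continuous_subspaceT.
Qed.

(** A translation is the product of two reflections, [t -> - c - t] and [t -> - t]. *)
Lemma Rintegral_translate h a b c : continuous h -> a <= b ->
  \int[mu]_(t in `[a, b]) h (t + c) = \int[mu]_(t in `[a + c, b + c]) h t.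
Proof.
move=> ch ab.
have chN : continuous (fun t => h (- t)).
  move=> t; apply: continuous_comp; last exact: ch.
  exact: opp_continuous.
have := @Rintegral_reflect (fun t => h (- t)) a b (- c) chN ab.
under eq_Rintegral do rewrite opprB opprK.
move=> ->.
have := @Rintegral_reflect h (- c - b) (- c - a) 0 ch.
rewrite lerD2l lerN2 => /(_ ab); rewrite !sub0r !opprB !opprK => <-.
by apply: eq_Rintegral => t _; rewrite sub0r.
Qed.

Lemma Rintegral_periodic h p a b : continuous h -> (forall t, h (t + p) = h t) ->
  0 <= p -> a <= 0 -> 0 <= b -> b - a = p ->
  \int[mu]_(t in `[a, b]) h t = \int[mu]_(t in `[0, p]) h t.
Proof.
move=> ch hp p0 a0 b0 bap; rewrite -(@Rintegral_itv_cat h a 0 b)//.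
(* The part to the left of 0 is moved by one period. *)
have -> : \int[mu]_(t in `[a, 0]) h t = \int[mu]_(t in `[b, p]) h t.
  have -> : b = a + p by rewrite -bap; ring.
  rewrite -{2}(add0r p) -Rintegral_translate//.
  by apply: eq_Rintegral => t _; rewrite hp.
rewrite addrC Rintegral_itv_cat//; lra.
Qed.

End interval_integrals.

(** * The divergence theorem on discs *)

Section disc_divergence.
Context {R : realType}.
Notation mu := (@lebesgue_measure R).
Implicit Types (u v w f : R * R -> R) (x : R * R) (rho : R).

(** Radial profiles are written in the square of the norm, which is polynomial and therefore smooth
    at the origin. *)
Definition nsq x : R := x.1 ^+ 2 + x.2 ^+ 2.

Definition disc_of rho : set (R * R) := [set x | enorm x < rho].

Lemma nsq_ge0 x : 0 <= nsq x.
Proof. by rewrite addr_ge0// sqr_ge0. Qed.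

Lemma enorm_lt rho x : 0 < rho -> (enorm x < rho) = (nsq x < rho ^+ 2).
Proof.
move=> r0; rewrite /enorm -[in LHS](ger0_norm (ltW r0)) -sqrtr_sqr ltr_sqrt//.
by rewrite exprn_gt0.
Qed.

Lemma continuous_nsq : continuous nsq.
Proof.
move=> x; apply: cvgD; apply: cvgM; by [exact: cvg_fst|exact: cvg_snd].
Qed.

Lemma continuous_pair {T : topologicalType} (g h : T -> R) :
  continuous g -> continuous h -> continuous (fun t => (g t, h t)).
Proof.
by move=> cg ch t; exact: (cvg_pair (cg t) (ch t)).
Qed.

Lemma continuous_comp2 {T : topologicalType} u (g h : T -> R) :
  continuous u -> continuous g -> continuous h ->
  continuous (fun t => u (g t, h t)).
Proof.
move=> cu cg ch t; apply: (@continuous_comp _ _ _ (fun t => (g t, h t)) u).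
  exact: continuous_pair.
exact: cu.
Qed.

Lemma open_disc_of rho : 0 < rho -> open (disc_of rho).
Proof.
move=> r0; have -> : disc_of rho = nsq @^-1` `]-oo, rho ^+ 2[%classic.
  by apply/seteqP; split=> x; rewrite /disc_of/= in_itv/= enorm_lt.
apply: open_comp; first by move=> x _; exact: continuous_nsq.
exact: interval_open.
Qed.

Lemma measurable_disc_of rho : 0 < rho -> measurable (disc_of rho).
Proof. by move=> r0; apply: open_measurable2; exact: open_disc_of. Qed.

Lemma disc_of_square rho : 0 < rho ->
  disc_of rho `<=` (`[- rho, rho] : set R) `*` (`[- rho, rho] : set R).
Proof.
move=> r0 [x y]; rewrite /disc_of/= enorm_lt// /nsq/= !in_itv/= => h.
by split; rewrite -ler_norml -[leRHS](ger0_norm (ltW r0)) -ler_sqr ?nnegrE//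
  !real_normK ?num_real//; nra.
Qed.

Lemma leb2_disc_of_lty rho : 0 < rho -> (leb2 (disc_of rho) < +oo)%E.
Proof.
move=> r0.
apply: (@le_lt_trans _ _
  (leb2 ((`[- rho, rho] : set R) `*` (`[- rho, rho] : set R)))).
  rewrite le_measure ?inE//; [exact: measurable_disc_of| |exact: disc_of_square].
  by apply: measurableX.
rewrite /leb2 product_measure1E//= lebesgue_measure_itv/= lte_fin.
by rewrite ifT ?EFinN ?ltry//; lra.
Qed.

Lemma continuous_bounded_disc f rho : continuous f -> 0 < rho ->
  exists M : R, 0 <= M /\ forall x, disc_of rho x -> `|f x| <= M.
Proof.
move=> cf r0.
have /compact_bounded[M [_ mrt]] : compact (f @`
   ((`[- rho, rho] : set R) `*` (`[- rho, rho] : set R))).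
  apply: continuous_compact; first exact: continuous_subspaceT.
  by apply: compact_setX; exact: segment_compact.
exists (`|M| + 1); split; first by rewrite addr_ge0.
move=> x xr; apply: mrt; first by rewrite ltr_pwDr// ler_norm.
by exists x => //; exact: disc_of_square.
Qed.

Lemma continuous_integrable_disc f rho : continuous f -> 0 < rho ->
  leb2.-integrable (disc_of rho) (EFin \o f).
Proof.
move=> cf r0; apply: measurable_bounded_integrable.
- exact: measurable_disc_of.
- exact: leb2_disc_of_lty.
- exact: continuous_measurable_fun2.
- have [M [_ hM]] := continuous_bounded_disc f rho cf r0.
  exists M; split; first exact: num_real.
  by move=> N MN x /= xr; apply: le_trans (ltW MN); exact: hM.
Qed.

Lemma periodic2pi (f : R -> R) : periodic f (pi *+ 2) ->
  forall t, f (t + 2 * pi) = f t.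
Proof. by move=> pf t; rewrite mulr_natl pf. Qed.

Lemma sin2piB (t : R) : sin (2 * pi - t) = - sin t.
Proof. by rewrite addrC (periodic2pi _ (@sinD2pi R)) sinN. Qed.

Lemma cos2piB (t : R) : cos (2 * pi - t) = cos t.
Proof. by rewrite addrC (periodic2pi _ (@cosD2pi R)) cosN. Qed.

(** The section of the disc at abscissa [z] is an open interval of half-length [sqrt (rho^2 - z^2)],
    empty for [|z| >= rho]; the fundamental theorem of calculus applies on it. *)
Lemma integral_disc_section w w2 rho (z : R) : 0 < rho -> continuous w2 ->
  (forall x, is_derive x ((0, 1) : R * R) w (w2 x)) ->
  (\int[mu]_y ((EFin \o w2) \_ (disc_of rho)) (z, y) =
  ((EFin \o (fun z => w (z, Num.sqrt (rho ^+ 2 - z ^+ 2)) -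
    w (z, - Num.sqrt (rho ^+ 2 - z ^+ 2)))%R) \_ `](- rho)%R, rho[) z)%E.
Proof.
move=> r0 cw2 dw.
have itvE (e y : R) : 0 <= e ->
    (y \in (`]- e, e[%classic : set R)) = (y ^+ 2 < e ^+ 2).
  move=> e0; rewrite mem_setE in_itv/= -ltr_norml -[in LHS](ger0_norm e0).
  by rewrite -ltr_sqr ?nnegrE// !real_normK ?num_real.
rewrite patchE itvE ?ltW//; case: ifPn => [zr|]; last first.
  rewrite -leNgt => zr; rewrite integral0_eq// => y _.
  rewrite patchE ifF//; apply/negbTE; rewrite notin_setE /disc_of/=.
  by rewrite enorm_lt// /nsq/= => h; have := sqr_ge0 y; lra.
rewrite [RHS]/=; set c := Num.sqrt _.
have c0 : 0 <= c by exact: sqrtr_ge0.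
have c2 : c ^+ 2 = rho ^+ 2 - z ^+ 2 by rewrite sqr_sqrtr//; lra.
have -> : (fun y => ((EFin \o w2) \_ (disc_of rho)) (z, y)) =
    (fun y => (w2 (z, y))%:E) \_ `]- c, c[.
  apply/funext => y; rewrite !patchE; congr (if _ then _ else _).
  rewrite itvE// c2.
  by apply/idP/idP; rewrite inE /disc_of/= enorm_lt// /nsq/=; lra.
have cs : continuous (fun y => w2 (z, y)).
  by apply: continuous_comp2 => // y; [exact: cvg_cst|exact: cvg_id].
rewrite -integral_mkcond -(@integral_itv_bndoo _ _ _ _ true false); last first.
  apply/measurable_EFinP; apply: measurable_funTS.
  exact: (continuous_measurable_fun cs).
have dy (y : R) : is_derive y 1 (fun y => w (z, y)) (w2 (z, y)).
  by have /is_derive_line2 := dw (z, y).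
have Ncc : - c <= c by lra.
by rewrite (integral_FTC2 _ _ _ _ Ncc cs dy).
Qed.

(** Under [z = rho cos t], decreasing on [[0, pi]], the upper boundary values give the integral over
    the upper half circle; the lower ones, through [t -> 2 pi - t], give that over the lower
    half. *)
Lemma integral_disc_iterated w w2 rho : 0 < rho ->
  continuous w -> continuous w2 ->
  (forall x, is_derive x ((0, 1) : R * R) w (w2 x)) ->
  (\int[mu]_z \int[mu]_y ((EFin \o w2) \_ (disc_of rho)) (z, y) =
  \int[mu]_(t in `[0%R, (2 * pi)%R])
     (rho * w (rho * cos t, rho * sin t) * sin t)%:E)%E.
Proof.
move=> r0 cw cw2 dw.
under eq_integral do rewrite (integral_disc_section _ _ _ _ r0 cw2 dw).
pose G z : R := w (z, Num.sqrt (rho ^+ 2 - z ^+ 2)) -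
  w (z, - Num.sqrt (rho ^+ 2 - z ^+ 2)).
rewrite -/G.
have cc : continuous (fun z : R => Num.sqrt (rho ^+ 2 - z ^+ 2)).
  move=> z; apply: continuous_comp; last exact: sqrt_continuous.
  by apply: cvgB; [exact: cvg_cst|exact: exprn_continuous].
have cG : continuous G.
  rewrite /G => z; apply: cvgB; apply: continuous_comp2 => // x; try exact: cvg_id.
  by apply: cvgN; exact: cc.
rewrite -integral_mkcond -(@integral_itv_bndoo _ _ _ _ true false); last first.
  apply/measurable_EFinP; apply: measurable_funTS.
  exact: (continuous_measurable_fun cG).
have crho : continuous (fun t => rho * cos t : R).
  by move=> t; apply: cvgM; [exact: cvg_cst|exact: continuous_cos].
have srho : continuous (fun t => rho * sin t : R).
  by move=> t; apply: cvgM; [exact: cvg_cst|exact: continuous_sin].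
have dF (t : R) : is_derive t 1 (fun t => rho * cos t) (- (rho * sin t)).
  by apply: is_derive_eq; rewrite /GRing.scale/= mulrN.
have dF1 : derive1 (fun t => rho * cos t) = fun t => - (rho * sin t).
  by apply/funext => t; rewrite derive1E; have [] := dF t.
have := @integration_by_substitution_decreasing _ (fun t => rho * cos t) G 0 pi.
rewrite cospi cos0 mulrN1 mulr1 => E; rewrite [LHS]E {E}; last 7 first.
- exact: pi_ge0.
- by move=> x y x0 y0 yx; rewrite ltr_pM2l// ltr_cos.
- by rewrite dF1 => t _; apply: cvgN; exact: srho.
- rewrite dF1; apply/cvg_ex; eexists; apply: cvg_at_right_filter.
  by apply: cvgN; exact: srho.
- rewrite dF1; apply/cvg_ex; eexists; apply: cvg_at_left_filter.
  by apply: cvgN; exact: srho.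
- split; first by move=> t _; have [] := dF t.
  + by apply: cvg_at_right_filter; exact: crho.
  + by apply: cvg_at_left_filter; exact: crho.
- exact: continuous_subspaceT.
pose h t : R := rho * w (rho * cos t, rho * sin t) * sin t.
have ch : continuous h.
  move=> t; apply: cvgM; last exact: continuous_sin.
  by apply: cvgM; [exact: cvg_cst|exact: continuous_comp2].
have ch' : continuous (fun t => h (2 * pi - t)).
  move=> t; apply: (@continuous_comp _ _ _ (fun t => 2 * pi - t) h); last exact: ch.
  by apply: cvgB; [exact: cvg_cst|exact: cvg_id].
transitivity (\int[mu]_(t in `[0%R, pi]) (h t + h (2 * pi - t))%:E)%E.
  apply: eq_integral => t; rewrite inE/= in_itv/= => t0pi; congr EFin.
  have st0 : 0 <= sin t by exact: sin_ge0_pi.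
  rewrite dF1.
  have sE : Num.sqrt (rho ^+ 2 - (rho * cos t) ^+ 2) = rho * sin t.
    have -> : rho ^+ 2 - (rho * cos t) ^+ 2 = (rho * sin t) ^+ 2.
      by rewrite !exprMn sin2cos2; ring.
    by rewrite sqrtr_sqr ger0_norm// mulr_ge0// ltW.
  transitivity (G (rho * cos t) * (rho * sin t)).
    by congr (_ * _); exact: opprK.
  by rewrite /h /G sE sin2piB cos2piB !mulrN; ring.
have pi0 := pi_ge0 R.
rewrite (@EFin_Rintegral_itv _ (fun t => h t + h (2 * pi - t))); last first.
  by move=> t; apply: cvgD; [exact: ch|exact: ch'].
rewrite EFin_Rintegral_itv// RintegralD//; first last.
- exact: continuous_integrable_itv.
- exact: continuous_integrable_itv.
rewrite Rintegral_reflect// subr0 (_ : 2 * pi - pi = pi); last by ring.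
by rewrite Rintegral_itv_cat//; lra.
Qed.

End disc_divergence.

Section divergence.
Context {R : realType}.
Notation mu := (@lebesgue_measure R).
Implicit Types (u v w f : R * R -> R) (x : R * R) (rho : R).

Lemma integrable_disc_patch f rho : continuous f -> 0 < rho ->
  (mu \x mu)%E.-integrable setT ((EFin \o f) \_ (disc_of rho)).
Proof.
move=> cf r0; rewrite -integrable_mkcond; last exact: measurable_disc_of.
exact: continuous_integrable_disc.
Qed.

Lemma Rintegral_disc_patch f rho :
  \int[leb2]_(x in disc_of rho) f x =
  fine (\int[mu \x mu]_x ((EFin \o f) \_ (disc_of rho)) x)%E.
Proof. by rewrite /Rintegral integral_mkcond. Qed.

Lemma continuous_circle u rho : continuous u ->
  continuous (fun t : R => u (rho * cos t, rho * sin t)).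
Proof.
move=> cu; apply: continuous_comp2 => // t.
  by apply: cvgM; [exact: cvg_cst|exact: continuous_cos].
by apply: cvgM; [exact: cvg_cst|exact: continuous_sin].
Qed.

Lemma divergence2 w w1 w2 rho : 0 < rho -> C1_with w w1 w2 ->
  \int[leb2]_(x in disc_of rho) w2 x =
  \int[mu]_(t in `[0, 2 * pi]) (rho * w (rho * cos t, rho * sin t) * sin t).
Proof.
move=> r0 [cw _ dw2 _ cw2].
rewrite [LHS]Rintegral_disc_patch.
have E := integral12_prod_meas1 (integrable_disc_patch _ _ cw2 r0).
rewrite -E (integral_disc_iterated w w2 rho r0 cw cw2 dw2).
by [].
Qed.

(** Exchanging the coordinates reduces this to the other derivative, with the opposite order of
    integration. On the circle the exchange is [t -> pi / 2 - t], undone by a reflection and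
    periodicity. *)
Lemma divergence1 w w1 w2 rho : 0 < rho -> C1_with w w1 w2 ->
  \int[leb2]_(x in disc_of rho) w1 x =
  \int[mu]_(t in `[0, 2 * pi]) (rho * w (rho * cos t, rho * sin t) * cos t).
Proof.
move=> r0 [cw dw1 _ cw1 _].
pose swap (f : R * R -> R) x := f (x.2, x.1).
have cswap f : continuous f -> continuous (swap f).
  by move=> cf; apply: continuous_comp2 => // x; [exact: cvg_snd|exact: cvg_fst].
have dw x : is_derive x ((0, 1) : R * R) (swap w) (swap w1 x).
  by apply/is_derive_line2; have /is_derive_line1 := dw1 (x.2, x.1).
transitivity (\int[mu]_(t in `[0, 2 * pi])
    (rho * w (rho * sin t, rho * cos t) * sin t)).
  rewrite [LHS]Rintegral_disc_patch.
  have E := integral21_prod_meas1 (integrable_disc_patch _ _ cw1 r0).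
  rewrite -E.
  have E2 := integral_disc_iterated (swap w) (swap w1) rho r0
    (cswap _ cw) (cswap _ cw1) dw.
  transitivity (fine (\int[mu]_z \int[mu]_y
      ((EFin \o swap w1) \_ (disc_of rho)) (z, y))%E); last first.
    by rewrite E2.
  apply: (f_equal fine).
  apply: eq_integral => y _.
  rewrite /fubini_G.
  apply: eq_integral => x _.
  rewrite !patchE; congr (if _ then _ else _).
  by apply/idP/idP; rewrite !inE /disc_of/= !enorm_lt// /nsq/= addrC.
pose h t : R := rho * w (rho * cos t, rho * sin t) * cos t.
have ch : continuous h.
  move=> t; apply: cvgM; last exact: continuous_cos.
  by apply: cvgM; [exact: cvg_cst|exact: continuous_circle].
transitivity (\int[mu]_(t in `[0, 2 * pi]) h (pi / 2 - t)).
  apply: eq_Rintegral => t _; rewrite /h.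
  have -> : sin (pi / 2 - t) = cos t.
    by rewrite addrC sinDpihalf cosN.
  by rewrite addrC cosDpihalf sinN opprK.
have pi0 := pi_ge0 R.
rewrite Rintegral_reflect//; last lra.
apply: Rintegral_periodic => //; last 4 first; try lra.
move=> t; rewrite /h (periodic2pi _ (@cosD2pi R)).
by rewrite (periodic2pi _ (@sinD2pi R)).
Qed.

Lemma is_derive_sinM (c t : R) :
  is_derive t 1 (fun t => sin (c * t)) (c * cos (c * t)).
Proof.
have dc : is_derive t 1 (fun t => c * t) c.
  by apply: is_derive_eq; rewrite /GRing.scale/= mulr1.
by apply: is_derive_eq (is_derive1_comp (is_derive_sin _) dc) _; rewrite mulrC.
Qed.

Lemma sin_natmul2pi k : sin (k%:R * (2 * pi)) = 0 :> R.
Proof.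
elim: k => [|k IH]; first by rewrite mul0r sin0.
by rewrite -[k.+1]addn1 natrD mulrDl mul1r (periodic2pi _ (@sinD2pi R)).
Qed.

Lemma continuous_cosM (c : R) : continuous (fun t => cos (c * t)).
Proof.
move=> t; apply: (@continuous_comp _ _ _ (fun t => c * t) cos).
  by apply: cvgM; [exact: cvg_cst|exact: cvg_id].
exact: continuous_cos.
Qed.

Lemma continuous_sinM (c : R) : continuous (fun t => sin (c * t)).
Proof.
move=> t; apply: (@continuous_comp _ _ _ (fun t => c * t) sin).
  by apply: cvgM; [exact: cvg_cst|exact: cvg_id].
exact: continuous_sin.
Qed.

Lemma Rintegral_cos2 n : (0 < n)%N ->
  \int[mu]_(t in `[0, 2 * pi]) cos (n%:R * t) ^+ 2 = pi.
Proof.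
move=> n0; have nN0 : n%:R != 0 :> R by rewrite pnatr_eq0 -lt0n.
have pi0 := pi_ge0 R.
pose F (t : R) := t / 2 + sin ((2 * n)%:R * t) / (4 * n%:R).
have dF (t : R) : is_derive t 1 F (cos (n%:R * t) ^+ 2).
  have dS := is_derive_sinM (2 * n)%:R t.
  apply: is_derive_eq; rewrite /GRing.scale/= natrM.
  have -> : 2 * n%:R * t = n%:R * t *+ 2 :> R by rewrite [RHS]mulr2n; ring.
  rewrite cos_mulr2n; field.
  by rewrite nN0.
have cc : continuous (fun t : R => cos (n%:R * t) ^+ 2).
  by move=> t; apply: cvgM; exact: continuous_cosM.
have l : 0 <= 2 * pi :> R by lra.
rewrite (Rintegral_FTC2 _ F _ _ l cc dF) /F sin_natmul2pi !mulr0 sin0; field.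
by rewrite nN0.
Qed.

Lemma Rintegral_sin2 n : (0 < n)%N ->
  \int[mu]_(t in `[0, 2 * pi]) sin (n%:R * t) ^+ 2 = pi.
Proof.
move=> n0; have pi0 := pi_ge0 R.
have cc : continuous (fun t : R => cos (n%:R * t) ^+ 2).
  by move=> t; apply: cvgM; exact: continuous_cosM.
have -> : \int[mu]_(t in `[0, 2 * pi]) sin (n%:R * t) ^+ 2 =
    \int[mu]_(t in `[0, 2 * pi]) (1 - cos (n%:R * t) ^+ 2).
  by apply: eq_Rintegral => t _; rewrite sin2cos2.
rewrite RintegralB//; last 2 first.
- by apply: continuous_integrable_itv; exact: cst_continuous.
- exact: continuous_integrable_itv.
rewrite Rintegral_cos2// Rintegral_cst//= lebesgue_measure_itv/= lte_fin.
case: ifPn => /= h; last by have := pi_gt0 R; lra.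
by lra.
Qed.

Lemma Rintegral_sin_cos n : (0 < n)%N ->
  \int[mu]_(t in `[0, 2 * pi]) (sin (n%:R * t) * cos (n%:R * t)) = 0.
Proof.
move=> n0; have nN0 : n%:R != 0 :> R by rewrite pnatr_eq0 -lt0n.
have pi0 := pi_ge0 R.
pose F (t : R) := sin (n%:R * t) ^+ 2 / (2 * n%:R).
have dF (t : R) : is_derive t 1 F (sin (n%:R * t) * cos (n%:R * t)).
  have dS := is_derive_sinM n%:R t.
  apply: is_derive_eq; rewrite /GRing.scale/=; field.
  by rewrite nN0.
have cc : continuous (fun t : R => sin (n%:R * t) * cos (n%:R * t)).
  by move=> t; apply: cvgM; [exact: continuous_sinM|exact: continuous_cosM].
have l : 0 <= 2 * pi :> R by lra.
by rewrite (Rintegral_FTC2 _ F _ _ l cc dF) /F sin_natmul2pi !mulr0 sin0; ring.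
Qed.

(** The area is read off the divergence theorem for the field [(0, y)], of divergence 1. *)
Lemma leb2_disc_of rho : 0 < rho -> leb2 (disc_of rho) = (pi * rho ^+ 2)%:E.
Proof.
move=> r0.
have fm : (leb2 (disc_of rho) \is a fin_num)%E.
  by rewrite ge0_fin_numE ?leb2_disc_of_lty//; exact: measure_ge0.
rewrite -(fineK fm); congr EFin.
rewrite -[LHS]mul1r -Rintegral_cst; last exact: measurable_disc_of.
rewrite (divergence2 _ _ _ _ r0 C1_with_snd)/=.
transitivity (\int[mu]_(t in `[0, 2 * pi]) (rho ^+ 2 * sin (1%:R * t) ^+ 2)).
  by apply: eq_Rintegral => t _; rewrite mul1r; ring.
rewrite RintegralZl//; last first.
  apply: continuous_integrable_itv => t.
  by apply: cvgM; exact: continuous_sinM.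
by rewrite Rintegral_sin2// mulrC.
Qed.

End divergence.

(** * Integrals of radial functions over the disc *)

Section radial_integrals.
Context {R : realType}.
Notation mu := (@lebesgue_measure R).

Let nnpi : {nonneg R} := NngNum (pi_ge0 R).

Lemma measurable_nsq D : measurable_fun D (@nsq R).
Proof. by apply: continuous_measurable_fun2; exact: continuous_nsq. Qed.

(* [x |-> |x|^2] pushes the plane Lebesgue measure to [pi] times the one of the
   half-line, because the disc of radius [sqrt s] has area [pi s]. *)
Lemma leb2_preimage_nsq (A : set R) : measurable A -> A `<=` [set s | 0 <= s] ->
  leb2 (@nsq R @^-1` A) = (pi%:E * mu A)%E.
Proof.
move=> mA A0; have mc : measurable (`[0, +oo[%classic : set R) by [].
pose m1 := pushforward (@leb2 R) (@nsq R).
pose m2 := mrestr (mscale nnpi mu) mc.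
(* Both measures give [pi * max 0 x] to []-oo, x[], and these half-lines generate the sigma-algebra
   and are stable under intersection. The restriction in [m2] reflects that [nsq] takes no negative
   value. *)
have E : m1 A = m2 A.
  pose G := [set A : set R | exists x, A = `]-oo, x[%classic].
  pose g (k : nat) : set R := `]-oo, k%:R[%classic.
  have mG (x : R) : m1 `]-oo, x[%classic = (pi * Num.max 0 x)%:E /\
                    m2 `]-oo, x[%classic = (pi * Num.max 0 x)%:E.
    have [x0|x0] := leP x 0.
      rewrite mulr0; split.
        rewrite /m1 /pushforward [X in leb2 X](_ : _ = set0); first exact: measure0.
        by apply/seteqP; split=> // y /=; rewrite in_itv/=; have := nsq_ge0 y; lra.
      rewrite /m2 /mrestr [X in mscale _ _ X](_ : _ = set0); first exact: measure0.
      by apply/seteqP; split=> // y /= []; rewrite !in_itv/=; lra.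
    have sx : 0 < Num.sqrt x by rewrite sqrtr_gt0.
    have sx2 : Num.sqrt x ^+ 2 = x by rewrite sqr_sqrtr// ltW.
    split.
      rewrite /m1 /pushforward [X in leb2 X](_ : _ = disc_of (Num.sqrt x)).
        by rewrite leb2_disc_of// sx2.
      by apply/seteqP; split=> y; rewrite /disc_of/= in_itv/= enorm_lt// sx2.
    rewrite /m2 /mrestr [X in mscale _ _ X](_ : _ = `[0, x[%classic).
      by rewrite /mscale/= lebesgue_measure_itv/= lte_fin x0 oppr0 adde0 EFinM.
    by apply/seteqP; split=> y /=; rewrite !in_itv/= ?andbT;
      [move=> [-> ->]|move=> /andP[-> ->]].
  apply: (@measure_unique _ R (measurableTypeR R) G g _ _ _ _
    (@pushforward _ _ _ (measurableTypeR R) _ (@leb2 R) (@nsq R))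
    (mrestr (mscale nnpi mu) mc)) => //.
  - exact: RGenInftyO.measurableE.
  - move=> _ _ [x ->] [y ->]; exists (Num.min x y).
    by apply/seteqP; split=> z /=; rewrite !in_itv/= lt_min;
      [move=> [-> ->]|move=> /andP[]].
  - by move=> k; exists k%:R.
  - apply/seteqP; split=> // x _; exists (Num.truncn `|x|).+1 => //=.
    rewrite /g/= in_itv/=; apply: le_lt_trans (ler_norm x) _.
    exact: truncnS_gt.
  - exact: measurable_nsq.
  - by move=> ? _ [x ->]; have [h1 h2] := mG x; exact: etrans h1 (esym h2).
  - move=> ? k; have [h1 _] := mG k%:R.
    by apply: (eq_ind_r (fun z => z < +oo)%E _ h1); rewrite ltry.
move: E; rewrite /m1 /m2 /pushforward /mrestr/= => ->.
rewrite /mscale/= (_ : A `&` _ = A)//; apply/setIidPl => x /A0/=.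
by rewrite in_itv/= andbT.
Qed.

Lemma integral_disc_radial (G : R -> R) :
  measurable_fun setT G -> (forall s, 0 <= G s) ->
  (\int[leb2]_(x in @disc R) (G (nsq x))%:E =
   pi%:E * \int[mu]_(s in `[0%R, 1%R]) (G s)%:E)%E.
Proof.
move=> mG G0.
have mE : measurable_fun setT (EFin \o G) by exact/measurable_EFinP.
have -> : @disc R = @nsq R @^-1` `[0, 1[%classic.
  apply/seteqP; split=> x; rewrite /disc/= enorm_lt// in_itv/= expr1n nsq_ge0//.
have -> : (\int[mu]_(s in `[0%R, 1%R]) (G s)%:E =
    \int[mu]_(s in `[0%R, 1%R[) (G s)%:E)%E.
  have mG01 : measurable_fun (`]0, 1[%classic : set R) (EFin \o G).
    exact: measurable_funTS.
  by rewrite (integral_itv_bndoo true true mG01) (integral_itv_bndoo true false mG01).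
pose P := @pushforward _ _ _ (measurableTypeR R) _ (@leb2 R) (@nsq R).
transitivity (\int[P]_(s in `[0%R, 1%R[) (G s)%:E)%E.
  rewrite ge0_integral_pushforward//.
  - exact: measurable_nsq.
  - exact: measurable_funTS.
  - by move=> y _; rewrite lee_fin.
transitivity (\int[mscale nnpi mu]_(s in `[0%R, 1%R[) (G s)%:E)%E; last first.
  rewrite ge0_integral_mscale//; first exact: measurable_funTS.
  by move=> x _; rewrite lee_fin.
apply: (@eq_measure_integral _ (measurableTypeR R) R _
  (mscale nnpi mu) (@pushforward _ _ _ (measurableTypeR R) _ (@leb2 R) (@nsq R))).
- exact: measurable_nsq.
- move=> ? A mA A01; apply: leb2_preimage_nsq => // s /A01 /=.
  by rewrite in_itv/= => /andP[].
Qed.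

End radial_integrals.

(** * Square integrable functions and traces *)

Section L2_facts.
Context {d} {T : measurableType d} {R : realType} {m : {measure set T -> \bar R}}.
Context {D : set T} (mD : measurable D).
Implicit Types (f g h w : T -> R).

Lemma integrable_addr f g : m.-integrable D (EFin \o f) ->
  m.-integrable D (EFin \o g) -> m.-integrable D (EFin \o (fun x => f x + g x)).
Proof. by move=> If Ig; exact: (integrableD mD If Ig). Qed.

Lemma integrable_scaler (c : R) f : m.-integrable D (EFin \o f) ->
  m.-integrable D (EFin \o (fun x => c * f x)).
Proof. by move=> If; exact: (integrableZl mD c If). Qed.

Lemma L2_integrable_sq f : L2 m D f -> m.-integrable D (EFin \o (fun x => f x ^+ 2)).
Proof.
move=> [mf f2]; apply/integrableP; split.
  by apply/measurable_EFinP; exact: measurable_funX.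
apply: le_lt_trans f2; rewrite le_eqVlt; apply/orP; left; apply/eqP.
by apply: eq_integral => x _; rewrite /= ger0_norm// sqr_ge0.
Qed.

Lemma L2_integrable_mul f g : L2 m D f -> L2 m D g ->
  m.-integrable D (EFin \o (fun x => f x * g x)).
Proof.
move=> Lf Lg; have If := L2_integrable_sq f Lf; have Ig := L2_integrable_sq g Lg.
apply: (@le_integrable _ _ _ m D mD _ (EFin \o (fun x => f x ^+ 2 + g x ^+ 2))).
- by apply/measurable_EFinP; apply: measurable_funM; [case: Lf|case: Lg].
- move=> x _; rewrite /= lee_fin [leRHS]ger0_norm ?addr_ge0 ?sqr_ge0//.
  have := sqr_ge0 (f x + g x); have := sqr_ge0 (f x - g x).
  have := sqr_ge0 (f x); have := sqr_ge0 (g x).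
  by rewrite ler_norml; move=> *; apply/andP; split; nra.
- exact: integrable_addr.
Qed.

Lemma L2B f g : L2 m D f -> L2 m D g -> L2 m D (fun x => f x - g x).
Proof.
move=> Lf Lg; split; first by apply: measurable_funB; [case: Lf|case: Lg].
have /integrableP[_] := integrable_addr _ _
  (integrable_scaler 2 _ (L2_integrable_sq f Lf))
  (integrable_scaler 2 _ (L2_integrable_sq g Lg)).
have [mf _] := Lf; have [mg _] := Lg.
apply: le_lt_trans; apply: ge0_le_integral => //.
- by move=> x _; rewrite lee_fin sqr_ge0.
- by apply/measurable_EFinP; apply: measurable_funX; exact: measurable_funB.
- apply/measurable_EFinP; apply: measurableT_comp => //.
  by apply: measurable_funD; apply: measurable_funM => //; exact: measurable_funX.
- move=> x Dx /=; rewrite lee_fin ger0_norm; last first.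
    by rewrite addr_ge0// mulr_ge0// sqr_ge0.
  by have := sqr_ge0 (f x + g x); nra.
Qed.

Lemma L2_mul_bounded w f M : measurable_fun D w ->
  (forall x, D x -> `|w x| <= M) -> L2 m D f -> L2 m D (fun x => w x * f x).
Proof.
move=> mw wM Lf; have [mf f2] := Lf; split; first exact: measurable_funM.
have := integrableZl mD (M ^+ 2) (L2_integrable_sq f Lf).
move=> /integrableP[_]; apply: le_lt_trans; apply: ge0_le_integral => //.
- by move=> x _; rewrite lee_fin sqr_ge0.
- apply/measurable_EFinP; apply: measurable_funX; exact: measurable_funM.
- apply/measurable_EFinP; apply: measurableT_comp => //.
  by apply: measurable_funM => //; exact: measurable_funX.
- move=> x Dx; rewrite /= lee_fin.
  rewrite [leRHS]ger0_norm; last by rewrite mulr_ge0// sqr_ge0.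
  rewrite [leLHS]exprMn ler_wpM2r ?sqr_ge0// -[w x ^+ 2]real_normK ?num_real//.
  by rewrite ler_sqr ?nnegrE ?wM// (le_trans (normr_ge0 (w x)))// wM.
Qed.

(** Cauchy-Schwarz in the form [|y g| <= del g^2 + y^2 / del], with [y = fk k - f]: [del] is fixed
    first, to make the integral of the first term small, and [k] is taken large afterwards. *)
Lemma L2_cvg_Rintegral (fk : nat -> T -> R) f g :
  (forall k, L2 m D (fk k)) -> L2 m D f -> L2 m D g -> L2_cvg m D fk f ->
  \int[m]_(x in D) (fk k x * g x) @[k --> \oo] --> \int[m]_(x in D) (f x * g x).
Proof.
move=> Lfk Lf Lg fkf; apply/cvgrPdist_lt => e e0.
have Ig := L2_integrable_sq g Lg.
set I := \int[m]_(x in D) g x ^+ 2.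
have I0 : 0 <= I by apply: Rintegral_ge0 => x _; exact: sqr_ge0.
pose del := e / (2 * (I + 1)).
have del0 : 0 < del by rewrite divr_gt0// mulr_gt0//; lra.
have Ie : del * I < e / 2.
  rewrite /del mulrAC ltr_pdivrMr; last by rewrite mulr_gt0//; lra.
  by nra.
have e20 : 0 < del * (e / 2) by rewrite mulr_gt0// divr_gt0.
have /fine_cvgP[_ /cvgrPdist_lt/(_ _ e20)] := fkf.
apply: filterS => k; rewrite sub0r normrN.
rewrite -[(fine \o _) k]/(\int[m]_(x in D) (fk k x - f x) ^+ 2) => kd.
have Ld : L2 m D (fun x => fk k x - f x) by exact: L2B.
have Id := L2_integrable_sq _ Ld.
rewrite ger0_norm in kd; last by apply: Rintegral_ge0 => x _; exact: sqr_ge0.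
rewrite distrC -RintegralB//; try exact: L2_integrable_mul.
under eq_Rintegral do rewrite -mulrBl.
have Idg := L2_integrable_mul _ _ Ld Lg.
apply: le_lt_trans (le_normr_Rintegral mD Idg) _.
have Is := integrable_addr _ _ (integrable_scaler del _ Ig)
  (integrable_scaler del^-1 _ Id).
apply: (@le_lt_trans _ _ (\int[m]_(x in D)
    (del * g x ^+ 2 + del^-1 * (fk k x - f x) ^+ 2))).
  apply: le_Rintegral => //; first exact: (integrable_norm Idg).
  move=> x _; set y := fk k x - f x.
  have dv : del * del^-1 = 1 by rewrite divff// gt_eqF.
  have dv0 : 0 < del^-1 by rewrite invr_gt0.
  have h1 := mulr_ge0 (ltW dv0) (sqr_ge0 (y - del * g x)).
  have h2 := mulr_ge0 (ltW dv0) (sqr_ge0 (y + del * g x)).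
  have h3 := mulr_ge0 (ltW del0) (sqr_ge0 (g x)).
  have h4 := mulr_ge0 (ltW dv0) (sqr_ge0 y).
  have E1 : del^-1 * (y - del * g x) ^+ 2 =
    del^-1 * y ^+ 2 + del * g x ^+ 2 - 2 * (y * g x).
    by field; rewrite gt_eqF.
  have E2 : del^-1 * (y + del * g x) ^+ 2 =
    del^-1 * y ^+ 2 + del * g x ^+ 2 + 2 * (y * g x).
    by field; rewrite gt_eqF.
  by rewrite ler_norml; apply/andP; split; lra.
rewrite RintegralD//; [|exact: integrable_scaler|exact: integrable_scaler].
rewrite !RintegralZl// -/I.
have : del^-1 * (\int[m]_(x in D) (fk k x - f x) ^+ 2) < e / 2.
  by rewrite mulrC ltr_pdivrMr// mulrC.
lra.
Qed.

End L2_facts.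

Section C1_in_H1.
Context {R : realType}.
Notation mu := (@lebesgue_measure R).
Implicit Types (u v w f : R * R -> R) (x : R * R).

Lemma measurable_disc : measurable (@disc R).
Proof. exact: (measurable_disc_of 1 ltr01). Qed.

Lemma continuous_L2_disc f : continuous f -> L2 (@leb2 R) (@disc R) f.
Proof.
move=> cf; split; first exact: continuous_measurable_fun2.
have cf2 : continuous (fun x => f x ^+ 2).
  by move=> x; apply: cvgM; exact: cf.
have /integrableP[_] := continuous_integrable_disc _ 1 cf2 ltr01.
apply: le_lt_trans; rewrite le_eqVlt; apply/orP; left; apply/eqP.
by apply: eq_integral => x _; rewrite /= ger0_norm// sqr_ge0.
Qed.

Lemma continuous_L2_angles (h : R -> R) : continuous h -> L2 mu (@angles R) h.
Proof.
move=> ch; split.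
  by apply: measurable_funTS; exact: continuous_measurable_fun.
have ch2 : continuous (fun t => h t ^+ 2).
  by move=> t; apply: cvgM; exact: ch.
have /integrableP[_] := continuous_integrable_itv _ 0 (2 * pi) ch2.
apply: le_lt_trans; rewrite le_eqVlt; apply/orP; left; apply/eqP.
by apply: eq_integral => t _; rewrite /= ger0_norm// sqr_ge0.
Qed.

Lemma test_function_circle phi (t : R) :
  test_function phi -> phi (cos t, sin t) = 0.
Proof.
move=> [_ [K [_ KD phi0]]]; apply: phi0 => /KD.
by rewrite /disc/= /enorm/= cos2Dsin2 sqrtr1 ltxx.
Qed.

Lemma divergence_disc1 w w1 w2 : C1_with w w1 w2 ->
  \int[leb2]_(x in @disc R) w1 x =
  \int[mu]_(t in @angles R) (w (cos t, sin t) * cos t).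
Proof.
move=> hw; rewrite [LHS](divergence1 w w1 w2 1 ltr01 hw).
by apply: eq_Rintegral => t _; rewrite !mul1r.
Qed.

Lemma divergence_disc2 w w1 w2 : C1_with w w1 w2 ->
  \int[leb2]_(x in @disc R) w2 x =
  \int[mu]_(t in @angles R) (w (cos t, sin t) * sin t).
Proof.
move=> hw; rewrite [LHS](divergence2 w w1 w2 1 ltr01 hw).
by apply: eq_Rintegral => t _; rewrite !mul1r.
Qed.

(** The classical derivatives are weak ones by the divergence theorem for [v * phi], whose boundary
    term vanishes with [phi]. *)
Lemma H1_C1 v v1 v2 : C1_with v v1 v2 -> H1 v (fun x => (v1 x, v2 x)).
Proof.
move=> hv; have [cv _ _ cv1 cv2] := hv.
split; try exact: continuous_L2_disc.
move=> phi tphi; have [sphi _] := tphi.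
have hphi := Ck1_C1_with _ (sphi 1%N); have [cphi _ _ cphi1 cphi2] := hphi.
have hvp := C1_withM _ _ _ _ _ _ hv hphi.
have cM f g : continuous f -> continuous g ->
    leb2.-integrable (@disc R) (EFin \o (fun x => f x * g x)).
  by move=> cf cg; apply: L2_integrable_mul;
    [exact: measurable_disc|exact: continuous_L2_disc|exact: continuous_L2_disc].
have Z (c : R -> R) : \int[mu]_(t in @angles R)
    (v (cos t, sin t) * phi (cos t, sin t) * c t) = 0.
  rewrite /Rintegral integral0_eq// => t _.
  by rewrite (test_function_circle _ _ tphi) mulr0 mul0r.
split.
- have := divergence_disc1 _ _ _ hvp.
  rewrite Z RintegralD//=; [|exact: measurable_disc|exact: cM|exact: cM].
  by move=> /eqP; rewrite addrC addr_eq0 => /eqP.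
- have := divergence_disc2 _ _ _ hvp.
  rewrite Z RintegralD//=; [|exact: measurable_disc|exact: cM|exact: cM].
  by move=> /eqP; rewrite addrC addr_eq0 => /eqP.
Qed.

Lemma L2_cvg_cst d (T : measurableType d) (m : {measure set T -> \bar R}) D
    (f : T -> R) :
  L2_cvg m D (fun=> f) f.
Proof.
have E k : (\int[m]_(x in D) ((((fun=> f) : nat -> T -> R) k x - f x) ^+ 2)%:E = 0)%E.
  by rewrite integral0_eq// => x _; rewrite subrr expr0n.
by rewrite /L2_cvg (funext E); exact: cvg_cst.
Qed.

(** A [C^1] function serves as its own approximating sequence. *)
Lemma H1_trace_C1 v v1 v2 : C1_with v v1 v2 ->
  H1_trace v (fun x => (v1 x, v2 x)) (on_circle v).
Proof.
move=> hv; have [cv _ _ cv1 cv2] := hv; have [ckv dv1 dv2] := C1_withP _ _ _ hv.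
split; first exact: H1_C1.
  apply: continuous_L2_angles => t; apply: continuous_comp2 => // s.
    exact: continuous_cos.
  exact: continuous_sin.
exists (fun=> v); split=> //; rewrite ?dv1 ?dv2; exact: L2_cvg_cst.
Qed.

(** For the [C^1] approximants [uk] this is the divergence theorem for [uk F]. Every integral that
    remains is linear in [uk] on the circle or in its gradient, and passes to the [L^2] limit. *)
Lemma green_H1_trace u (g : R * R -> R * R) (f : R -> R) F1 F11 F12 F2 F21 F22 :
  H1_trace u g f -> C1_with F1 F11 F12 -> C1_with F2 F21 F22 ->
  (forall x, F11 x + F22 x = 0) ->
  \int[leb2]_(x in @disc R) ((g x).1 * F1 x + (g x).2 * F2 x) =
  \int[mu]_(t in @angles R)
    (f t * (F1 (cos t, sin t) * cos t + F2 (cos t, sin t) * sin t)).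
Proof.
move=> [[Lu Lg1 Lg2 _] Lf [uk [cuk uku gk1 gk2 fk]]] hF1 hF2 divF.
have [cF1 _ _ cF11 cF12] := hF1; have [cF2 _ _ cF21 cF22] := hF2.
have hk k := Ck1_C1_with _ (cuk k).
have LF1 := continuous_L2_disc _ cF1; have LF2 := continuous_L2_disc _ cF2.
have mD := measurable_disc.
have Lk1 k : L2 leb2 (@disc R) (d1 (uk k)).
  by have [_ _ _ c1 _] := hk k; exact: continuous_L2_disc.
have Lk2 k : L2 leb2 (@disc R) (d2 (uk k)).
  by have [_ _ _ _ c2] := hk k; exact: continuous_L2_disc.
have cl1 := L2_cvg_Rintegral (m := (mu \x mu)%E) mD _ _ _ Lk1 Lg1 LF1 gk1.
have cl2 := L2_cvg_Rintegral (m := (mu \x mu)%E) mD _ _ _ Lk2 Lg2 LF2 gk2.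
have ccs (h : R * R -> R) : continuous h -> continuous (fun t : R => h (cos t, sin t)).
  move=> ch; apply: continuous_comp2 => // t; first exact: continuous_cos.
  exact: continuous_sin.
pose nu t : R := F1 (cos t, sin t) * cos t + F2 (cos t, sin t) * sin t.
have cnu : continuous nu.
  by move=> t; apply: cvgD; apply: cvgM;
    [exact: ccs|exact: continuous_cos|exact: ccs|exact: continuous_sin].
have Lnu := continuous_L2_angles _ cnu.
have cuk' k : continuous (on_circle (uk k)).
  by have [ck _ _ _ _] := hk k; exact: ccs.
have Lcuk k := continuous_L2_angles _ (cuk' k).
have mA : measurable (@angles R : set (measurableTypeR R)) by exact: measurable_itv.
have cr := L2_cvg_Rintegral (m := mu) mA _ _ _ Lcuk Lf Lnu fk.
have Ek k : \int[leb2]_(x in @disc R) (d1 (uk k) x * F1 x) +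
    \int[leb2]_(x in @disc R) (d2 (uk k) x * F2 x) =
    \int[mu]_(t in @angles R) (on_circle (uk k) t * nu t).
  have [ck _ _ ck1 ck2] := hk k.
  have h1 := C1_withM _ _ _ _ _ _ (hk k) hF1.
  have h2 := C1_withM _ _ _ _ _ _ (hk k) hF2.
  have [_ _ _ c1 _] := h1; have [_ _ _ _ c2] := h2.
  have e1 := divergence_disc1 _ _ _ h1; have e2 := divergence_disc2 _ _ _ h2.
  have iD w : continuous w -> leb2.-integrable (@disc R) (EFin \o w).
    by move=> cw; exact: (continuous_integrable_disc _ 1 cw ltr01).
  have cM (f1 f2 : R * R -> R) : continuous f1 -> continuous f2 ->
      continuous (fun x => f1 x * f2 x).
    by move=> cf1 cf2 x; apply: cvgM; [exact: cf1|exact: cf2].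
  rewrite -RintegralD//; [|apply: iD; exact: cM|apply: iD; exact: cM].
  (* Adding [uk (F11 + F22) = 0] completes the products to derivatives of [uk F1] and [uk F2]. *)
  have -> : \int[leb2]_(x in @disc R) (d1 (uk k) x * F1 x + d2 (uk k) x * F2 x) =
      \int[leb2]_(x in @disc R) ((d1 (uk k) x * F1 x + uk k x * F11 x) +
      (d2 (uk k) x * F2 x + uk k x * F22 x)).
    apply: eq_Rintegral => x _.
    have -> : F22 x = - F11 x by have := divF x; lra.
    by ring.
  rewrite RintegralD//; [|exact: iD|exact: iD].
  rewrite e1 e2 -RintegralD//.
  - by apply: eq_Rintegral => t _; rewrite /nu /on_circle; ring.
  - apply: continuous_integrable_itv => t; apply: cvgM; last exact: continuous_cos.
    by apply: (ccs (fun x => uk k x * F1 x)); exact: cM.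
  - apply: continuous_integrable_itv => t; apply: cvgM; last exact: continuous_sin.
    by apply: (ccs (fun x => uk k x * F2 x)); exact: cM.
have cl : (\int[leb2]_(x in @disc R) (d1 (uk k) x * F1 x) +
    \int[leb2]_(x in @disc R) (d2 (uk k) x * F2 x)) @[k --> \oo] -->
    \int[leb2]_(x in @disc R) ((g x).1 * F1 x) +
    \int[leb2]_(x in @disc R) ((g x).2 * F2 x).
  exact: cvgD cl1 cl2.
rewrite (funext Ek) in cl.
rewrite [LHS]RintegralD//.
- by rewrite -(cvg_lim (@Rhausdorff R) cl) (cvg_lim (@Rhausdorff R) cr).
- exact: (L2_integrable_mul (m := (mu \x mu)%E) mD _ _ Lg1 LF1).
- exact: (L2_integrable_mul (m := (mu \x mu)%E) mD _ _ Lg2 LF2).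
Qed.

End C1_in_H1.

(** * Radially modulated harmonic polynomials *)

Section trial_functions.
Context {R : realType}.
Notation mu := (@lebesgue_measure R).
Implicit Types (u v w : R * R -> R) (x : R * R) (f : R -> R).

(* The plane is read as C: [zpow n x] is the n-th power of [x]. *)
Fixpoint zpow (n : nat) x : R * R :=
  if n is n'.+1 then
    (x.1 * (zpow n' x).1 - x.2 * (zpow n' x).2,
     x.1 * (zpow n' x).2 + x.2 * (zpow n' x).1)
  else (1, 0).

Definition Zre n x := (zpow n x).1.
Definition Zim n x := (zpow n x).2.

Lemma ZreS n x : Zre n.+1 x = x.1 * Zre n x - x.2 * Zim n x.
Proof. by []. Qed.

Lemma ZimS n x : Zim n.+1 x = x.1 * Zim n x + x.2 * Zre n x.
Proof. by []. Qed.

Lemma Z_circle n (t : R) :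
  zpow n (cos t, sin t) = (cos (n%:R * t), sin (n%:R * t)).
Proof.
elim: n => [|n IH] /=; first by rewrite mul0r cos0 sin0.
rewrite IH /= -[n.+1]addn1 natrD mulrDl mul1r cosD sinD.
by congr (_, _); ring.
Qed.

Lemma Z_nsq n x : Zre n x ^+ 2 + Zim n x ^+ 2 = nsq x ^+ n.
Proof.
elim: n => [|n IH]; first by rewrite /Zre /Zim /= expr0; ring.
by rewrite [RHS]exprS -IH ZreS ZimS /nsq; ring.
Qed.

Lemma C1_with_ext u u1 u2 v v1 v2 : C1_with u u1 u2 ->
  (forall x, u x = v x) -> (forall x, u1 x = v1 x) -> (forall x, u2 x = v2 x) ->
  C1_with v v1 v2.
Proof. by move=> + /funext <- /funext <- /funext <-. Qed.

Lemma C1_withZ (c : R) u u1 u2 : C1_with u u1 u2 ->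
  C1_with (fun x => c * u x) (fun x => c * u1 x) (fun x => c * u2 x).
Proof.
move=> hu; apply: C1_with_ext (C1_withM _ _ _ _ _ _ (C1_with_cst c) hu) _ _ _ => // x;
  ring.
Qed.

(** The Cauchy-Riemann equations for [z^n], with complex derivative [n z^(n-1)]. *)
Lemma C1_with_Z n :
  C1_with (Zre n) (fun x => n%:R * Zre n.-1 x) (fun x => - (n%:R * Zim n.-1 x)) /\
  C1_with (Zim n) (fun x => n%:R * Zim n.-1 x) (fun x => n%:R * Zre n.-1 x).
Proof.
elim: n => [|n [IH1 IH2]].
  split; first by apply: C1_with_ext (C1_with_cst 1) _ _ _ => // x;
    rewrite !mul0r ?oppr0.
  by apply: C1_with_ext (C1_with_cst 0) _ _ _ => // x; rewrite !mul0r ?oppr0.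
(* The factor [n] makes the recursion hold at [n = 0] too, where [n.-1] is the default value 0. *)
have hn x : n%:R * Zre n x = n%:R * (x.1 * Zre n.-1 x - x.2 * Zim n.-1 x) /\
    n%:R * Zim n x = n%:R * (x.1 * Zim n.-1 x + x.2 * Zre n.-1 x).
  by case: (n) => [|k]; rewrite ?mul0r// /= ZreS ZimS.
split.
- apply: C1_with_ext (C1_withD _ _ _ _ _ _ (C1_withM _ _ _ _ _ _ C1_with_fst IH1)
    (C1_withM _ _ _ _ _ _ (C1_withZ (-1) _ _ _ C1_with_snd) IH2)) _ _ _ => x.
  + by rewrite ZreS; ring.
  + have [h1 h2] := hn x.
    by rewrite /= -[n.+1]addn1 natrD mulrDl h1; ring.
  + have [h1 h2] := hn x.
    by rewrite /= -[n.+1]addn1 natrD mulrDl h2; ring.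
- apply: C1_with_ext (C1_withD _ _ _ _ _ _ (C1_withM _ _ _ _ _ _ C1_with_fst IH2)
    (C1_withM _ _ _ _ _ _ C1_with_snd IH1)) _ _ _ => x.
  + by rewrite ZimS; ring.
  + have [h1 h2] := hn x.
    by rewrite /= -[n.+1]addn1 natrD mulrDl h2; ring.
  + have [h1 h2] := hn x.
    by rewrite /= -[n.+1]addn1 natrD mulrDl h1; ring.
Qed.

Lemma C1_with_nsq :
  C1_with (@nsq R) (fun x => 2 * x.1) (fun x => 2 * x.2).
Proof.
apply: C1_with_ext (C1_withD _ _ _ _ _ _
  (C1_withM _ _ _ _ _ _ C1_with_fst C1_with_fst)
  (C1_withM _ _ _ _ _ _ C1_with_snd C1_with_snd)) _ _ _ => x; rewrite /nsq; ring.
Qed.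

Section trial.
Variables (n : nat) (e e' e'' : R -> R).
Hypotheses (de : forall s : R, is_derive s 1 e (e' s))
  (de' : forall s : R, is_derive s 1 e' (e'' s)) (ce'' : continuous e'').

Definition tcos x := e (nsq x) * Zre n x.
Definition tcos1 x := 2 * x.1 * e' (nsq x) * Zre n x + n%:R * e (nsq x) * Zre n.-1 x.
Definition tcos2 x := 2 * x.2 * e' (nsq x) * Zre n x - n%:R * e (nsq x) * Zim n.-1 x.
Definition tsin x := e (nsq x) * Zim n x.
Definition tsin1 x := 2 * x.1 * e' (nsq x) * Zim n x + n%:R * e (nsq x) * Zim n.-1 x.
Definition tsin2 x := 2 * x.2 * e' (nsq x) * Zim n x + n%:R * e (nsq x) * Zre n.-1 x.

Let ce' : continuous e'. Proof. exact: derivable_continuous de'. Qed.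

Let he := C1_with_comp _ _ _ _ _ de ce' C1_with_nsq.
Let he' := C1_with_comp _ _ _ _ _ de' ce'' C1_with_nsq.

Lemma C1_with_tcos : C1_with tcos tcos1 tcos2.
Proof.
have [hr hi] := C1_with_Z n.
apply: C1_with_ext (C1_withM _ _ _ _ _ _ he hr) _ _ _ => // x;
  rewrite /tcos1 /tcos2; ring.
Qed.

Lemma C1_with_tsin : C1_with tsin tsin1 tsin2.
Proof.
have [hr hi] := C1_with_Z n.
apply: C1_with_ext (C1_withM _ _ _ _ _ _ he hi) _ _ _ => // x;
  rewrite /tsin1 /tsin2; ring.
Qed.

(* The cross terms, of angular frequency [2n], cancel in the sum of the energies
   of the real and imaginary parts: what remains is radial. *)
Lemma trial_energy x : (0 < n)%N ->
  tcos1 x ^+ 2 + tcos2 x ^+ 2 + (tsin1 x ^+ 2 + tsin2 x ^+ 2) =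
  2 * (nsq x ^+ n.-1 * ((n%:R * e (nsq x) + nsq x * e' (nsq x)) ^+ 2
                        + (nsq x * e' (nsq x)) ^+ 2)).
Proof.
rewrite /tcos1 /tcos2 /tsin1 /tsin2; case: n => // k _.
rewrite -[k.+1.-1]/k !ZreS !ZimS -Z_nsq.
move: (e _) (e' _) => E E'; rewrite /nsq; ring.
Qed.

(** The field is the gradient of [tsin] turned by a right angle: mixed second derivatives agree, so
    it is divergence-free, and its flux through the circle is the tangential derivative of
    [e 1 * sin (n t)]. It is paired with the cosine datum because, for constant [e], it is the
    gradient of the cosine mode. *)
Lemma green_tsin u g f : (0 < n)%N -> H1_trace u g f ->
  \int[leb2]_(x in @disc R) ((g x).1 * tsin2 x + (g x).2 * - tsin1 x) =
  \int[mu]_(t in @angles R) (f t * (n%:R * e 1 * cos (n%:R * t))).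
Proof.
move=> n0 ug.
have [hr hi] := C1_with_Z n; have [hr' hi'] := C1_with_Z n.-1.
have hx := C1_withM _ _ _ _ _ _ (C1_withM _ _ _ _ _ _
  (C1_withZ 2 _ _ _ C1_with_fst) he') hi.
have hy := C1_withM _ _ _ _ _ _ (C1_withM _ _ _ _ _ _
  (C1_withZ 2 _ _ _ C1_with_snd) he') hi.
have h1 := C1_withZ (-1) _ _ _ (C1_withD _ _ _ _ _ _ hx
  (C1_withM _ _ _ _ _ _ (C1_withZ n%:R _ _ _ he) hi')).
have h2 := C1_withD _ _ _ _ _ _ hy
  (C1_withM _ _ _ _ _ _ (C1_withZ n%:R _ _ _ he) hr').
transitivity (\int[leb2]_(x in @disc R) ((g x).1 * tsin2 x + (g x).2 * (- 1 * tsin1 x))).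
  by apply: eq_Rintegral => x _; rewrite mulN1r.
rewrite (green_H1_trace _ _ _ _ _ _ _ _ _ ug h2 h1); last by move=> x /=; ring.
apply: eq_Rintegral => t _; congr (_ * _).
have -> : nsq (cos t, sin t) = 1 by rewrite /nsq /= cos2Dsin2.
rewrite /Zim /Zre !Z_circle /=.
have -> : cos (n%:R * t) = cos (n.-1%:R * t) * cos t - sin (n.-1%:R * t) * sin t.
  by rewrite -cosD -[in LHS](prednK n0) -addn1 natrD mulrDl mul1r.
ring.
Qed.

Lemma green_tcos u g f : (0 < n)%N -> H1_trace u g f ->
  \int[leb2]_(x in @disc R) ((g x).1 * - tcos2 x + (g x).2 * tcos1 x) =
  \int[mu]_(t in @angles R) (f t * (n%:R * e 1 * sin (n%:R * t))).
Proof.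
move=> n0 ug.
have [hr hi] := C1_with_Z n; have [hr' hi'] := C1_with_Z n.-1.
have hx := C1_withM _ _ _ _ _ _ (C1_withM _ _ _ _ _ _
  (C1_withZ 2 _ _ _ C1_with_fst) he') hr.
have hy := C1_withM _ _ _ _ _ _ (C1_withM _ _ _ _ _ _
  (C1_withZ (- 2) _ _ _ C1_with_snd) he') hr.
have h1 := C1_withD _ _ _ _ _ _ hx
  (C1_withM _ _ _ _ _ _ (C1_withZ n%:R _ _ _ he) hr').
have h2 := C1_withD _ _ _ _ _ _ hy
  (C1_withM _ _ _ _ _ _ (C1_withZ n%:R _ _ _ he) hi').
transitivity (\int[leb2]_(x in @disc R) ((g x).1 *
    (- 2 * x.2 * e' (nsq x) * Zre n x + n%:R * e (nsq x) * Zim n.-1 x) +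
    (g x).2 * tcos1 x)).
  by apply: eq_Rintegral => x _; rewrite /tcos2; ring.
rewrite (green_H1_trace _ _ _ _ _ _ _ _ _ ug h2 h1); last by move=> x /=; ring.
apply: eq_Rintegral => t _; congr (_ * _).
have -> : nsq (cos t, sin t) = 1 by rewrite /nsq /= cos2Dsin2.
rewrite /Zim /Zre !Z_circle /=.
have -> : sin (n%:R * t) = sin (n.-1%:R * t) * cos t + cos (n.-1%:R * t) * sin t.
  by rewrite -sinD -[in LHS](prednK n0) -addn1 natrD mulrDl mul1r.
ring.
Qed.

End trial.
End trial_functions.

(** * Dirichlet and Thomson principles *)

Section weighted_forms.
Context {R : realType}.
Notation mu := (@lebesgue_measure R).
Implicit Types (u v w : R * R -> R) (x : R * R) (f : R -> R) (g h F : R * R -> R * R).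

Definition L2field g : Prop :=
  L2 (@leb2 R) (@disc R) (fst \o g) /\ L2 (@leb2 R) (@disc R) (snd \o g).

Definition weight w : Prop := measurable_fun (@disc R) w /\
  exists lo hi : R, 0 < lo /\ forall x, @disc R x -> lo <= w x <= hi.

Lemma weight_gt0 w x : weight w -> @disc R x -> 0 < w x.
Proof.
move=> [_ [lo [hi [lo0 h]]]] /h /andP[h1 _]; exact: lt_le_trans lo0 h1.
Qed.

Lemma weight_inv w : weight w -> weight (fun x => (w x)^-1).
Proof.
move=> hw; have [mw [lo [hi [lo0 h]]]] := hw; split.
  apply: (@measurable_comp _ _ _ _ _ _ (`]0, +oo[%classic : set R)
    (@GRing.inv R) _ w) => //.
    by move=> _ [x dx <-] /=; rewrite in_itv/= andbT; exact: weight_gt0.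
  apply: open_continuous_measurable_fun; first exact: interval_open.
  move=> t; rewrite inE/= in_itv/= andbT => t0.
  by apply: inv_continuous; rewrite gt_eqF.
exists hi^-1, lo^-1; split.
  (* A point of the disc is needed to know that [hi] is positive. *)
  have [x dx] : exists x, @disc R x.
    by exists (0, 0); rewrite /disc/= /enorm/= !expr0n/= addr0 sqrtr0.
  have := h x dx; rewrite invr_gt0; lra.
move=> x dx; have := h x dx; have w0 := weight_gt0 w x hw dx => /andP[h1 h2].
by rewrite !lef_pV2 ?posrE ?h1 ?h2//; lra.
Qed.

Lemma integrable_form w g h : weight w -> L2field g -> L2field h ->
  leb2.-integrable (@disc R) (EFin \o (fun x => w x * dot (g x) (h x))).
Proof.
move=> [mw [lo [hi [lo0 hb]]]] [g1 g2] [h1 h2].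
have wM x : @disc R x -> `|w x| <= hi.
  by move=> /hb /andP[l1 l2]; rewrite ger0_norm//; lra.
have mD := @measurable_disc R.
have wg1 := L2_mul_bounded (m := (mu \x mu)%E) mD _ _ _ mw wM g1.
have wg2 := L2_mul_bounded (m := (mu \x mu)%E) mD _ _ _ mw wM g2.
have I := integrable_addr (m := (mu \x mu)%E) mD _ _
  (L2_integrable_mul (m := (mu \x mu)%E) mD _ _ wg1 h1)
  (L2_integrable_mul (m := (mu \x mu)%E) mD _ _ wg2 h2).
apply: (eq_integrable (mu := (mu \x mu)%E) mD _ _ _ I) => x _.
by rewrite /dot /=; congr EFin; ring.
Qed.

Lemma integrable_dot g h : L2field g -> L2field h ->
  leb2.-integrable (@disc R) (EFin \o (fun x => dot (g x) (h x))).
Proof.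
move=> Lg Lh; have w1 : weight (fun=> 1).
  split; first exact: measurable_cst.
  by exists 1, 1; split=> // x _; rewrite lexx.
apply: (eq_integrable (mu := (mu \x mu)%E) measurable_disc _ _ _
  (integrable_form _ _ _ w1 Lg Lh)) => x _.
by rewrite /= mul1r.
Qed.

Lemma dirichlet_formC w g h : dirichlet_form w g h = dirichlet_form w h g.
Proof.
by apply: eq_Rintegral => x _; rewrite /dot; ring.
Qed.

(** This is the energy of [c g - h]. With [g] the gradient of a solution and [h] that of a trial
    function having [c] times its trace, it yields Dirichlet's principle. *)
Lemma dirichlet_form_square w g h (c : R) : weight w -> L2field g -> L2field h ->
  0 <= c ^+ 2 * dirichlet_form w g g - 2 * c * dirichlet_form w g h +
       dirichlet_form w h h.
Proof.
move=> hw Lg Lh; have mD := @measurable_disc R.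
have Igg := integrable_form _ _ _ hw Lg Lg.
have Igh := integrable_form _ _ _ hw Lg Lh.
have Ihh := integrable_form _ _ _ hw Lh Lh.
have I1 := integrable_scaler (m := (mu \x mu)%E) mD (c ^+ 2) _ Igg.
have I2 := integrable_scaler (m := (mu \x mu)%E) mD (- (2 * c)) _ Igh.
have I12 := integrable_addr (m := (mu \x mu)%E) mD _ _ I1 I2.
rewrite /dirichlet_form -mulNr -RintegralZl// -RintegralZl//.
rewrite -RintegralD// -RintegralD//.
apply: Rintegral_ge0 => x dx; rewrite /dot.
have w0 := ltW (weight_gt0 w x hw dx).
have := mulr_ge0 w0 (addr_ge0 (sqr_ge0 (c * (g x).1 - (h x).1))
                              (sqr_ge0 (c * (g x).2 - (h x).2))).
move=> h0; apply: (le_trans h0); rewrite le_eqVlt; apply/orP; left; apply/eqP; ring.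
Qed.

(** This is the integral of [|w g - F|^2 / w]. For a divergence-free [F] the middle term is known
    from boundary data, which yields Thomson's principle. *)
Lemma dirichlet_form_dual w g F : weight w -> L2field g -> L2field F ->
  0 <= dirichlet_form w g g - 2 * \int[leb2]_(x in @disc R) dot (g x) (F x) +
       dirichlet_form (fun x => (w x)^-1) F F.
Proof.
move=> hw Lg LF; have mD := @measurable_disc R.
have Igg := integrable_form _ _ _ hw Lg Lg.
have IgF := integrable_dot _ _ Lg LF.
have IFF := integrable_form _ _ _ (weight_inv _ hw) LF LF.
have I2 := integrable_scaler (m := (mu \x mu)%E) mD (- 2) _ IgF.
have I12 := integrable_addr (m := (mu \x mu)%E) mD _ _ Igg I2.
rewrite /dirichlet_form -mulNr -RintegralZl//.
rewrite -RintegralD// -RintegralD//.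
apply: Rintegral_ge0 => x dx; rewrite /dot.
have w0 := weight_gt0 w x hw dx; have w0i : 0 < (w x)^-1 by rewrite invr_gt0.
have := mulr_ge0 (ltW w0i) (addr_ge0 (sqr_ge0 (w x * (g x).1 - (F x).1))
                              (sqr_ge0 (w x * (g x).2 - (F x).2))).
move=> h0; apply: (le_trans h0); rewrite le_eqVlt; apply/orP; left; apply/eqP; field.
by rewrite gt_eqF.
Qed.

End weighted_forms.

Section variational.
Context {R : realType}.
Notation mu := (@lebesgue_measure R).
Implicit Types (x : R * R).

Lemma Rintegral_trig n (A B E F : R) : (0 < n)%N ->
  \int[mu]_(t in @angles R) ((A * cos (n%:R * t) + B * sin (n%:R * t)) *
     (E * cos (n%:R * t) + F * sin (n%:R * t))) = (A * E + B * F) * pi.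
Proof.
move=> n0.
have cc := @continuous_cosM R n%:R; have cs := @continuous_sinM R n%:R.
have I (c : R) (h : R -> R) : continuous h ->
    mu.-integrable (@angles R) (EFin \o (fun t => c * h t)).
  move=> ch; apply: continuous_integrable_itv => t.
  by apply: cvgM; [exact: cvg_cst|exact: ch].
have cM (f g : R -> R) : continuous f -> continuous g ->
    continuous (fun t => f t * g t).
  by move=> cf cg t; apply: cvgM; [exact: cf|exact: cg].
have c2 := cM _ _ cc cc; have s2 := cM _ _ cs cs; have sc := cM _ _ cs cc.
have mA : measurable (@angles R : set (measurableTypeR R)) by exact: measurable_itv.
transitivity (\int[mu]_(t in @angles R) ((A * E) * (cos (n%:R * t) * cos (n%:R * t)) +
   ((A * F + B * E) * (sin (n%:R * t) * cos (n%:R * t)) +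
    (B * F) * (sin (n%:R * t) * sin (n%:R * t))))).
  by apply: eq_Rintegral => t _; ring.
have I2 := integrable_addr (m := mu) mA _ _ (I (A * F + B * E) _ sc) (I (B * F) _ s2).
rewrite RintegralD//; last exact: I.
rewrite RintegralD//; [|exact: I|exact: I].
have J (h : R -> R) : continuous h -> mu.-integrable (@angles R) (EFin \o h).
  by move=> ch; exact: continuous_integrable_itv.
rewrite !RintegralZl//; [|exact: J|exact: J|exact: J].
have := @Rintegral_cos2 R n n0; under eq_Rintegral do rewrite expr2; move=> ->.
have := @Rintegral_sin2 R n n0; under eq_Rintegral do rewrite expr2; move=> ->.
rewrite Rintegral_sin_cos//; ring.
Qed.

(** As [c] may still be complex, multiplication by it mixes the cosine and sine data. The identity
    defining [is_DN] holds for every extension of every trace, so [v] may carry any combination of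
    the two. *)
Lemma dn_pairing gam n (c : R[i]) :
  (0 < n)%N ->
  is_DNC gam (expi n) (functional_of (fun t : R => c * n%:R * expi n t)) ->
  exists uc gc us gs,
    [/\ H1_trace uc gc (fun t => cos (n%:R * t)),
        H1_trace us gs (fun t => sin (n%:R * t)) &
        forall v gv (E F : R),
          H1_trace v gv (fun t => E * cos (n%:R * t) + F * sin (n%:R * t)) ->
          dirichlet_form gam gc gv = n%:R * (complex.Re c * E - complex.Im c * F) * pi /\
          dirichlet_form gam gs gv = n%:R * (complex.Im c * E + complex.Re c * F) * pi].
Proof.
move=> n0 [Lre [Lim [[uc [gc [[Hc _] Lc]]] [us [gs [[Hs _] Ls]]] HL]]].
exists uc, gc, us, gs; split => // v gv E F hv.
have := HL _ (ex_intro _ v (ex_intro _ gv hv)).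
rewrite /functional_of => -[e1 e2].
rewrite -(Lc _ _ _ hv) -(Ls _ _ _ hv) -e1 -e2.
have nR : (n%:R : R[i]) = n%:R%:C by rewrite rmorph_nat.
split.
- transitivity (\int[mu]_(t in @angles R)
    (((n%:R * complex.Re c) * cos (n%:R * t) +
      (- (n%:R * complex.Im c)) * sin (n%:R * t)) *
     (E * cos (n%:R * t) + F * sin (n%:R * t)))).
    apply: eq_Rintegral => t _; congr (_ * _).
    by rewrite nR; case: (c) => p q; simpc => /=; ring.
  by rewrite Rintegral_trig//; ring.
- transitivity (\int[mu]_(t in @angles R)
    (((n%:R * complex.Im c) * cos (n%:R * t) + (n%:R * complex.Re c) * sin (n%:R * t)) *
     (E * cos (n%:R * t) + F * sin (n%:R * t)))).
    apply: eq_Rintegral => t _; congr (_ * _).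
    by rewrite nR; case: (c) => p q; simpc => /=; ring.
  by rewrite Rintegral_trig//; ring.
Qed.

(** Half the sum of the energy densities of the cosine and sine modes with profile [e], in the
    variable [s = |x|^2]. *)
Definition mode_density n (e e' : R -> R) (s : R) : R :=
  s ^+ n.-1 * ((n%:R * e s + s * e' s) ^+ 2 + (s * e' s) ^+ 2).

Lemma continuous_mode_density n (e e' : R -> R) : continuous e -> continuous e' ->
  continuous (mode_density n e e').
Proof.
move=> ce ce' s.
have sp : (t * e' t) @[t --> s] --> s * e' s.
  by apply: cvgM; [exact: cvg_id|exact: ce'].
apply: cvgM; first exact: exprn_continuous.
have cX (f : R -> R) (l : R) : f t @[t --> s] --> l -> f t ^+ 2 @[t --> s] --> l ^+ 2.
  by move=> fl; apply: cvgM.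
apply: cvgD; apply: cX => //; apply: cvgD => //.
by apply: cvgM; [exact: cvg_cst|exact: ce].
Qed.

Lemma mode_density_ge0 n (e e' : R -> R) s : 0 <= s -> 0 <= mode_density n e e' s.
Proof. by move=> s0; rewrite mulr_ge0 ?exprn_ge0// addr_ge0// sqr_ge0. Qed.

Lemma H1_trace_L2field v gv f : H1_trace v gv f -> @L2field R gv.
Proof. by move=> [[_ h1 h2 _] _ _]. Qed.

(** The first bound comes from the trial functions, the second from their rotated gradients. Neither
    divides by [p], whose sign is not known at this point. *)
Lemma dn_energy_bounds gam n (c : R[i]) : weight gam -> (0 < n)%N ->
  is_DNC gam (expi n) (functional_of (fun t : R => c * n%:R * expi n t)) ->
  exists p : R, c = p%:C /\ forall e e' e'' : R -> R,
    (forall s : R, is_derive s 1 e (e' s)) ->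
    (forall s : R, is_derive s 1 e' (e'' s)) -> continuous e'' ->
    p * n%:R * e 1 ^+ 2 * pi <=
      \int[leb2]_(x in @disc R) (gam x * mode_density n e e' (nsq x)) /\
    n%:R * (2 * e 1 - p) * pi <=
      \int[leb2]_(x in @disc R) ((gam x)^-1 * mode_density n e e' (nsq x)).
Proof.
move=> hw n0 /(dn_pairing _ _ _ n0)[uc [gc [us [gs [Hc Hs HL]]]]].
have Lc := H1_trace_L2field _ _ _ Hc; have Ls := H1_trace_L2field _ _ _ Hs.
have nN0 : n%:R != 0 :> R by rewrite pnatr_eq0 -lt0n.
have n0R : 0 < n%:R :> R by rewrite ltr0n.
have pi0 := pi_gt0 R.
have E10 : (fun t : R => cos (n%:R * t)) =
    (fun t => 1 * cos (n%:R * t) + 0 * sin (n%:R * t)).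
  by apply/funext => t; ring.
have E01 : (fun t : R => sin (n%:R * t)) =
    (fun t => 0 * cos (n%:R * t) + 1 * sin (n%:R * t)).
  by apply/funext => t; ring.
have Hc' := Hc; have Hs' := Hs; rewrite E10 in Hc'; rewrite E01 in Hs'.
have [Bcc Bsc] := HL _ _ _ _ Hc'; have [Bcs Bss] := HL _ _ _ _ Hs'.
(* The form is symmetric, so its two mixed values, [n (Im c) pi] and [- n (Im c) pi], agree. *)
have q0 : complex.Im c = 0.
  have : n%:R * (complex.Im c * 1 + complex.Re c * 0) * pi =
         n%:R * (complex.Re c * 0 - complex.Im c * 1) * pi.
    by rewrite -Bsc -Bcs dirichlet_formC.
  rewrite !mulr0 !mulr1 addr0 sub0r => /eqP.
  rewrite -subr_eq0 -mulrBl -mulrBr !mulf_eq0 (negbTE nN0) (gt_eqF pi0) orbF /=.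
  by rewrite opprK -mulr2n mulrn_eq0 => /eqP.
exists (complex.Re c); split; first by case: (c) q0 => a b /= ->.
set p := complex.Re c; rewrite q0 -/p in Bcc Bss HL.
move=> e e' e'' de de' ce''.
pose gtcos x := (tcos1 n e e' x, tcos2 n e e' x).
pose gtsin x := (tsin1 n e e' x, tsin2 n e e' x).
pose Fc x := (tsin2 n e e' x, - tsin1 n e e' x).
pose Fs x := (- tcos2 n e e' x, tcos1 n e e' x).
have htcos := C1_with_tcos n e e' e'' de de'.
have htsin := C1_with_tsin n e e' e'' de de'.
have [_ _ _ ctcos1 ctcos2] := htcos; have [_ _ _ ctsin1 ctsin2] := htsin.
have cN (h : R * R -> R) : continuous h -> continuous (fun x => - h x).
  by move=> ch x; apply: cvgN; exact: ch.
have Lgtcos : L2field gtcos by split; exact: continuous_L2_disc.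
have Lgtsin : L2field gtsin by split; exact: continuous_L2_disc.
have LFc : L2field Fc by split; apply: continuous_L2_disc => //; exact: cN.
have LFs : L2field Fs by split; apply: continuous_L2_disc => //; exact: cN.
have nsq1 (t : R) : nsq (cos t, sin t) = 1 by rewrite /nsq /= cos2Dsin2.
have Tc : H1_trace (tcos n e) gtcos (fun t => e 1 * cos (n%:R * t) + 0 * sin (n%:R * t)).
  rewrite [X in H1_trace _ _ X](_ : _ = on_circle (tcos n e)); first exact: H1_trace_C1.
  by apply/funext => t; rewrite /on_circle /tcos /Zre Z_circle nsq1 /=; ring.
have Ts : H1_trace (tsin n e) gtsin (fun t => 0 * cos (n%:R * t) + e 1 * sin (n%:R * t)).
  rewrite [X in H1_trace _ _ X](_ : _ = on_circle (tsin n e)); first exact: H1_trace_C1.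
  by apply/funext => t; rewrite /on_circle /tsin /Zim Z_circle nsq1 /=; ring.
have [Bcv _] := HL _ _ _ _ Tc; have [_ Bsv] := HL _ _ _ _ Ts.
have Gc : \int[leb2]_(x in @disc R) dot (gc x) (Fc x) = n%:R * e 1 * pi.
  rewrite [LHS](green_tsin n e e' e'' de de' ce'' _ _ _ n0 Hc).
  transitivity (\int[mu]_(t in @angles R)
      ((1 * cos (n%:R * t) + 0 * sin (n%:R * t)) *
      ((n%:R * e 1) * cos (n%:R * t) + 0 * sin (n%:R * t)))).
    by apply: eq_Rintegral => t _; ring.
  by rewrite Rintegral_trig//; ring.
have Gs : \int[leb2]_(x in @disc R) dot (gs x) (Fs x) = n%:R * e 1 * pi.
  rewrite [LHS](green_tcos n e e' e'' de de' ce'' _ _ _ n0 Hs).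
  transitivity (\int[mu]_(t in @angles R)
      ((0 * cos (n%:R * t) + 1 * sin (n%:R * t)) *
      (0 * cos (n%:R * t) + (n%:R * e 1) * sin (n%:R * t)))).
    by apply: eq_Rintegral => t _; ring.
  by rewrite Rintegral_trig//; ring.
have energyE w : weight w ->
    2 * \int[leb2]_(x in @disc R) (w x * mode_density n e e' (nsq x)) =
    dirichlet_form w gtcos gtcos + dirichlet_form w gtsin gtsin.
  move=> hww; have mD := @measurable_disc R.
  have Ic := integrable_form _ _ _ hww Lgtcos Lgtcos.
  have Is := integrable_form _ _ _ hww Lgtsin Lgtsin.
  have E2 x : w x * dot (gtcos x) (gtcos x) + w x * dot (gtsin x) (gtsin x) =
      2 * (w x * mode_density n e e' (nsq x)).
    rewrite -mulrDr /mode_density mulrCA -(trial_energy n e e' x n0).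
    by rewrite /dot /=; ring.
  have I2 := integrable_addr (m := (mu \x mu)%E) mD _ _ Ic Is.
  have I3 := integrable_scaler (m := (mu \x mu)%E) mD 2^-1 _ I2.
  rewrite -[RHS]RintegralD//.
  under [RHS]eq_Rintegral do rewrite E2.
  rewrite RintegralZl//.
  apply: (eq_integrable (mu := (mu \x mu)%E) mD _ _ _ I3) => x _.
  by rewrite /= E2 mulKf.
(* A rotation by a right angle preserves the dot product, so the same radial density serves both
   principles. *)
have energyF w : dirichlet_form w gtcos gtcos + dirichlet_form w gtsin gtsin =
    dirichlet_form w Fs Fs + dirichlet_form w Fc Fc.
  by congr (_ + _); apply: eq_Rintegral => x _; rewrite /dot /=; ring.
split.
  have := dirichlet_form_square _ _ _ (e 1) hw Lc Lgtcos.
  have := dirichlet_form_square _ _ _ (e 1) hw Ls Lgtsin.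
  have := energyE _ hw.
  rewrite Bcc Bss Bcv Bsv; nra.
have := dirichlet_form_dual _ _ _ hw Lc LFc.
have := dirichlet_form_dual _ _ _ hw Ls LFs.
have := energyE _ (weight_inv _ hw).
rewrite energyF Bcc Bss Gc Gs; nra.
Qed.

End variational.

(** * The optimal radial profile *)

Section smoothed_profile.
Context {R : realType}.

(** A remainder bound holding for all [h] gives the derivative at once at points where the formula
    for [f] changes. *)
Lemma is_derive_quadratic (f : R -> R) (t d K : R) :
  (forall h, `|f (h + t) - f t - h * d| <= K * h ^+ 2) -> is_derive t 1 f d.
Proof.
move=> fK.
have K0 : 0 <= K by have := fK 1; rewrite expr1n mulr1; apply: le_trans.
have cf : h^-1 *: (f (h *: 1 + t) - f t) @[h --> 0^'] --> d.
  apply/cvgrPdist_le => e e0.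
  have eK0 : 0 < e / (K + 1) by rewrite divr_gt0//; lra.
  near=> h.
  have h0 : h != 0 by near: h; exact: nbhs_dnbhs_neq.
  have he : `|h| < e / (K + 1).
    near: h; exact: dnbhs0_lt.
  have -> : d - h^-1 *: (f (h *: 1 + t) - f t) =
      - (h^-1 * (f (h + t) - f t - h * d)).
    by rewrite /GRing.scale/= mulr1; field.
  rewrite normrN normrM normfV.
  have hp : 0 < `|h| by rewrite normr_gt0.
  rewrite mulrC ler_pdivrMr//; apply: le_trans (fK h) _.
  rewrite -[h ^+ 2]real_normK ?num_real// expr2 mulrA ler_wpM2r//.
  move: he; rewrite ltr_pdivlMr; last lra.
  by move=> he; nra.
by apply: DeriveDef; [exact: cvgP cf|exact: cvg_lim cf].
Unshelve. all: by end_near. Qed.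

Definition ppart (t : R) : R := Num.max t 0.

Lemma ppart_ge0 t : 0 <= ppart t.
Proof. by rewrite /ppart le_max lexx orbT. Qed.

Lemma ppart_id t : 0 <= t -> ppart t = t.
Proof. by move=> t0; rewrite /ppart max_l. Qed.

Lemma ppart_0 t : t <= 0 -> ppart t = 0.
Proof. by move=> t0; rewrite /ppart max_r. Qed.

Lemma continuous_ppart : continuous ppart.
Proof. by move=> t; apply: continuous_max; [exact: cvg_id|exact: cvg_cst]. Qed.

Lemma is_derive_ppart2 (t : R) : is_derive t 1 (fun t => ppart t ^+ 2) (2 * ppart t).
Proof.
apply: (is_derive_quadratic _ _ _ 1) => h; rewrite mul1r.
have [ht|ht] := leP 0 (h + t); have [t0|t0] := leP 0 t;
  rewrite ?(ppart_id (h + t) ht) ?(ppart_0 (h + t) (ltW ht))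
          ?(ppart_id t t0) ?(ppart_0 t (ltW t0)) ler_norml;
  apply/andP; split; nra.
Qed.

(** Since [t_+^3 = t * t_+^2], the product rule applies. *)
Lemma is_derive_ppart3 (t : R) :
  is_derive t 1 (fun t => ppart t ^+ 3) (3 * ppart t ^+ 2).
Proof.
have pE s : ppart s ^+ 3 = s * ppart s ^+ 2.
  by have [s0|s0] := leP 0 s; rewrite ?(ppart_id s s0) ?(ppart_0 s (ltW s0)); ring.
rewrite (funext pE).
have d2 := is_derive_ppart2 t.
apply: is_derive_eq; rewrite /GRing.scale/=.
by have [s0|s0] := leP 0 t; rewrite ?(ppart_id t s0) ?(ppart_0 t (ltW s0)); ring.
Qed.

Variables (c : R) (n : nat) (A B : R).
Hypotheses (c0 : 0 < c).

Section fixed_eps.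
Variables (eps : R).
Hypothesis (eps0 : 0 < eps).

(* A C^2 regularization of [Num.max s c]: with [t = s - c], the positive part of
   [t] is replaced by [t_+^3 / (t^2 + eps)]. *)
Definition ybase (s : R) : R := c + ppart (s - c) ^+ 3 * ((s - c) ^+ 2 + eps)^-1.

Definition ybase1 (s : R) : R :=
  3 * ppart (s - c) ^+ 2 * ((s - c) ^+ 2 + eps)^-1 -
  2 * (s - c) * ppart (s - c) ^+ 3 * ((s - c) ^+ 2 + eps) ^- 2.

Definition ybase2 (s : R) : R :=
  6 * ppart (s - c) * ((s - c) ^+ 2 + eps)^-1 -
  (12 * (s - c) * ppart (s - c) ^+ 2 + 2 * ppart (s - c) ^+ 3) *
     ((s - c) ^+ 2 + eps) ^- 2 +
  8 * (s - c) ^+ 2 * ppart (s - c) ^+ 3 * ((s - c) ^+ 2 + eps) ^- 3.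

Let den_gt0 s : 0 < (s - c) ^+ 2 + eps.
Proof. by rewrite ltr_wpDl ?sqr_ge0. Qed.

Lemma ybase_ge s : c <= ybase s.
Proof.
by rewrite lerDl mulr_ge0// ?exprn_ge0// ?ppart_ge0// invr_ge0 ltW.
Qed.

Let dsh (s : R) : is_derive s 1 (fun s => s - c) 1.
Proof. by apply: is_derive_eq; rewrite subr0. Qed.

Let dp2 (s : R) : is_derive s 1 (fun s => ppart (s - c) ^+ 2) (2 * ppart (s - c)).
Proof.
have := @is_derive1_comp _ (fun t => ppart t ^+ 2) (fun s => s - c) s _ _
  (is_derive_ppart2 (s - c)) (dsh s).
by rewrite mulr1.
Qed.

Let dp3 (s : R) :
  is_derive s 1 (fun s => ppart (s - c) ^+ 3) (3 * ppart (s - c) ^+ 2).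
Proof.
have := @is_derive1_comp _ (fun t => ppart t ^+ 3) (fun s => s - c) s _ _
  (is_derive_ppart3 (s - c)) (dsh s).
by rewrite mulr1.
Qed.

Let dden (s : R) : is_derive s 1 (fun s => (s - c) ^+ 2 + eps) (2 * (s - c)).
Proof. by apply: is_derive_eq; rewrite /GRing.scale/=; ring. Qed.

Let dinv (s : R) : is_derive s 1 (fun s => ((s - c) ^+ 2 + eps)^-1)
  (- (2 * (s - c) * ((s - c) ^+ 2 + eps) ^- 2)).
Proof.
have h : (s - c) ^+ 2 + eps != 0 by rewrite gt_eqF.
have dV := @is_deriveV _ (fun s => (s - c) ^+ 2 + eps) s _ 1 h (dden s).
apply: is_derive_eq dV _.
by rewrite /GRing.scale/=; field.
Qed.

Lemma is_derive_ybase (s : R) : is_derive s 1 ybase (ybase1 s).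
Proof.
rewrite /ybase; have := dp3 s; have := dinv s => h1 h2.
apply: is_derive_eq; rewrite /GRing.scale/= /ybase1.
have h : (s - c) ^+ 2 + eps != 0 by rewrite gt_eqF.
by field.
Qed.

Let dinv2 (s : R) : is_derive s 1 (fun s => ((s - c) ^+ 2 + eps) ^- 2)
  (- (4 * (s - c) * ((s - c) ^+ 2 + eps) ^- 3)).
Proof.
have h : (s - c) ^+ 2 + eps != 0 by rewrite gt_eqF.
have h2 : ((s - c) ^+ 2 + eps) ^+ 2 != 0 by rewrite expf_neq0.
have d2 : is_derive s 1 (fun s => ((s - c) ^+ 2 + eps) ^+ 2)
    (2 * ((s - c) ^+ 2 + eps) * (2 * (s - c))).
  by have := dden s => d1; apply: is_derive_eq; rewrite /GRing.scale/=; ring.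
have dV := @is_deriveV _ (fun s => ((s - c) ^+ 2 + eps) ^+ 2) s _ 1 h2 d2.
apply: is_derive_eq dV _.
by rewrite /GRing.scale/=; field.
Qed.

Lemma is_derive_ybase1 (s : R) : is_derive s 1 ybase1 (ybase2 s).
Proof.
rewrite /ybase1.
have h1 := dp3 s; have h2 := dp2 s; have h3 := dinv s; have h4 := dinv2 s.
have h5 := dsh s.
apply: is_derive_eq; rewrite /GRing.scale/= /ybase2.
have h : (s - c) ^+ 2 + eps != 0 by rewrite gt_eqF.
by field.
Qed.

Lemma continuous_ybase2 : continuous ybase2.
Proof.
have cs : continuous (fun s => s - c).
  by move=> s; apply: cvgB; [exact: cvg_id|exact: cvg_cst].
have cp : continuous (fun s => ppart (s - c)).
  move=> s; apply: (@continuous_comp _ _ _ (fun s => s - c) ppart); first exact: cs.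
  exact: continuous_ppart.
have cX (f : R -> R) k : continuous f -> continuous (fun s => f s ^+ k).
  move=> cf s; apply: (@continuous_comp _ _ _ f (fun t => t ^+ k)); first exact: cf.
  exact: exprn_continuous.
have cM (f g : R -> R) : continuous f -> continuous g ->
    continuous (fun s => f s * g s).
  by move=> cf cg s; apply: cvgM; [exact: cf|exact: cg].
have cD (f g : R -> R) : continuous f -> continuous g ->
    continuous (fun s => f s + g s).
  by move=> cf cg s; apply: cvgD; [exact: cf|exact: cg].
have cC (k : R) : continuous (fun _ : R => k) by exact: cst_continuous.
have cI k : continuous (fun s => ((s - c) ^+ 2 + eps) ^- k).
  have ch : continuous (fun s => ((s - c) ^+ 2 + eps) ^+ k).
    by apply: (cX _ k); apply: cD => //; exact: (cX _ 2 cs).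
  by move=> s; apply: cvgV; [rewrite expf_neq0// gt_eqF|exact: ch].
have c1 := cM _ _ (cM _ _ (cC 6) cp) (cI 1%N).
have c2 := cM _ _ (cD _ _ (cM _ _ (cM _ _ (cC 12) cs) (cX _ 2 cp))
  (cM _ _ (cC 2) (cX _ 3 cp))) (cI 2).
have c3 := cM _ _ (cM _ _ (cM _ _ (cC 8) (cX _ 2 cs)) (cX _ 3 cp)) (cI 3).
apply: cD c3; move=> s; apply: cvgB; [exact: c1|exact: c2].
Qed.

(** The bound is uniform in [eps], as dominated convergence requires. With [z = (s - c)^2] the
    derivative is [(z^2 + 3 eps z) / (z + eps)^2] for [s > c], and twice the denominator exceeds the
    numerator by [z^2 + eps z + 2 eps^2]. *)
Lemma ybase1_bound s : 0 <= ybase1 s <= 2.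
Proof.
have [s0|s0] := leP s c.
  have -> : ybase1 s = 0.
    by rewrite /ybase1 ppart_0 ?subr_le0// !expr0n/= !mulr0 !mul0r subrr.
  lra.
have t0 : 0 < s - c by lra.
have D0 := den_gt0 s.
have -> : ybase1 s = ((s - c) ^+ 4 + 3 * eps * (s - c) ^+ 2) / ((s - c) ^+ 2 + eps) ^+ 2.
  by rewrite /ybase1 ppart_id ?ltW//; field; rewrite gt_eqF.
apply/andP; split.
  apply: divr_ge0; last by rewrite exprn_ge0// ltW.
  by rewrite addr_ge0 ?exprn_ge0 ?(ltW t0)// mulr_ge0 ?sqr_ge0// mulr_ge0// ltW.
rewrite ler_pdivrMr ?exprn_gt0//.
have -> : (s - c) ^+ 4 = ((s - c) ^+ 2) ^+ 2 by rewrite -exprM.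
have := eps0; have := sqr_ge0 (s - c); move: (_ ^+ 2) => z z0 e0; nra.
Qed.

Lemma is_derive_ybaseV k (s : R) : is_derive s 1 (fun s => ybase s ^- k)
  (- (k%:R * ybase1 s * ybase s ^- k.+1)).
Proof.
have y0 : ybase s != 0 by rewrite gt_eqF//; apply: lt_le_trans c0 (ybase_ge s).
case: k => [|k].
  rewrite mul0r mul0r oppr0 (_ : (fun s => _) = cst 1); first exact: is_derive_cst.
  by apply/funext => z; rewrite expr0 invr1.
have dy := is_derive_ybase s.
have dX : is_derive s 1 (fun s => ybase s ^+ k.+1) (k.+1%:R * ybase s ^+ k * ybase1 s).
  by have := is_deriveX k.+1 dy; rewrite exprfctE.
have yk : ybase s ^+ k != 0 by rewrite expf_neq0.
have dV := @is_deriveV _ (fun s => ybase s ^+ k.+1) s _ 1 (expf_neq0 k.+1 y0) dX.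
apply: is_derive_eq dV _.
rewrite /GRing.scale/= !exprS expr0 mulr1.
by field; rewrite y0 yk.
Qed.

Definition prof (s : R) : R := A + B * ybase s ^- n.
Definition prof1 (s : R) : R := - (n%:R * B * ybase1 s * ybase s ^- n.+1).
Definition prof2 (s : R) : R := - (n%:R * B *
  (ybase2 s * ybase s ^- n.+1 - n.+1%:R * ybase1 s ^+ 2 * ybase s ^- n.+2)).

Lemma is_derive_prof (s : R) : is_derive s 1 prof (prof1 s).
Proof.
rewrite /prof; have dV := is_derive_ybaseV n s.
by apply: is_derive_eq; rewrite /GRing.scale/= /prof1; ring.
Qed.

Lemma is_derive_prof1 (s : R) : is_derive s 1 prof1 (prof2 s).
Proof.
rewrite /prof1; have dV := is_derive_ybaseV n.+1 s; have d1 := is_derive_ybase1 s.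
by apply: is_derive_eq; rewrite /GRing.scale/= /prof2; ring.
Qed.

Lemma continuous_prof2 : continuous prof2.
Proof.
have cV k := derivable_continuous _ _ (is_derive_ybaseV k).
have c1 := derivable_continuous _ _ is_derive_ybase1.
move=> s; apply: cvgN; apply: cvgM; first exact: cvg_cst.
apply: cvgB; first by apply: cvgM; [exact: continuous_ybase2|exact: cV].
apply: cvgM; last exact: cV.
by apply: cvgM; [exact: cvg_cst|apply: cvgM; exact: c1].
Qed.

Let ybaseV_le k s : 0 <= ybase s ^- k <= c ^- k.
Proof.
have y0 : 0 < ybase s by apply: lt_le_trans c0 (ybase_ge s).
rewrite invr_ge0 exprn_ge0 ?(ltW y0)//= lef_pV2 ?posrE ?exprn_gt0//.
apply: lerXn2r; [exact: ltW|exact: ltW|exact: ybase_ge].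
Qed.

Lemma prof_bound s : `|prof s| <= `|A| + `|B| * c ^- n.
Proof.
rewrite (le_trans (ler_normD _ _))// lerD2l normrM ler_wpM2l//.
by have /andP[h1 h2] := ybaseV_le n s; rewrite ger0_norm.
Qed.

Lemma prof1_bound s : `|prof1 s| <= n%:R * `|B| * 2 * c ^- n.+1.
Proof.
have /andP[h1 h2] := ybaseV_le n.+1 s; have /andP[h3 h4] := ybase1_bound s.
rewrite normrN !normrM (ger0_norm h1) (ger0_norm h3) (ger0_norm (ler0n R n)).
by rewrite ler_pM// ?mulr_ge0// ler_pM// mulr_ge0.
Qed.

(** On this side [ybase] is the constant [c] whatever [eps]: the regularization only perturbs the
    exterior. *)
Lemma prof_in s : s <= c -> prof s = A + B * c ^- n /\ prof1 s = 0.
Proof.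
move=> sc; have p0 : ppart (s - c) = 0 by rewrite ppart_0// subr_le0.
rewrite /prof /prof1 /ybase /ybase1 p0 !expr0n/= !mul0r addr0; split=> //.
by rewrite !mulr0 !mul0r subrr mulr0 mul0r oppr0.
Qed.

End fixed_eps.
End smoothed_profile.

(** * Removal of the regularization *)

Section profile_limit.
Context {R : realType}.
Notation mu := (@lebesgue_measure R).
Variables (c : R) (n : nat) (A B : R).
Hypotheses (c0 : 0 < c) (n0 : (0 < n)%N).

(** Outside, [e = A + B s^-n] has [s e' = - n B s^-n] and [n e + s e' = n A], so no cross term
    remains. The point [s = c] belongs to the inner case because the regularized derivative vanishes
    there. *)
Definition mode_density_lim (s : R) : R :=
  if s <= c then s ^+ n.-1 * (n%:R * (A + B * c ^- n)) ^+ 2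
  else s ^+ n.-1 * ((n%:R * A) ^+ 2 + (n%:R * B * s ^- n) ^+ 2).

Local Notation eps k := (@harmonic R k).
Local Notation prof_ k := (prof c n A B (eps k)).
Local Notation prof1_ k := (prof1 c n B (eps k)).

Lemma cvgXn (u : nat -> R) (l : R) j : u k @[k --> \oo] --> l ->
  u k ^+ j @[k --> \oo] --> l ^+ j.
Proof.
move=> ul.
exact: (cvg_comp u (fun t => t ^+ j) ul (@exprn_continuous R j l)).
Qed.

Lemma cvgVXn (u : nat -> R) (l : R) j : l != 0 -> u k @[k --> \oo] --> l ->
  u k ^- j @[k --> \oo] --> l ^- j.
Proof. by move=> l0 ul; apply: cvgV; [exact: expf_neq0|exact: cvgXn]. Qed.

Lemma cvg_ybase s : c < s -> ybase c (eps k) s @[k --> \oo] --> s.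
Proof.
move=> cs; have t0 : 0 < s - c by rewrite subr_gt0.
have D : ((s - c) ^+ 2 + eps k) @[k --> \oo] --> (s - c) ^+ 2 + 0.
  by apply: cvgD; [exact: cvg_cst|exact: cvg_harmonic].
rewrite addr0 in D; have D0 : (s - c) ^+ 2 != 0 by rewrite expf_neq0// gt_eqF.
rewrite [X in _ --> X](_ : s = c + (s - c) ^+ 3 * ((s - c) ^+ 2)^-1); last first.
  by field; rewrite gt_eqF.
rewrite /ybase ppart_id ?ltW//; apply: cvgD; first exact: cvg_cst.
by apply: cvgM; [exact: cvg_cst|exact: cvgV].
Qed.

Lemma cvg_ybase1 s : c < s -> ybase1 c (eps k) s @[k --> \oo] --> (1 : R).
Proof.
move=> cs; have t0 : 0 < s - c by rewrite subr_gt0.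
have D : ((s - c) ^+ 2 + eps k) @[k --> \oo] --> (s - c) ^+ 2 + 0.
  by apply: cvgD; [exact: cvg_cst|exact: cvg_harmonic].
rewrite addr0 in D; have D0 : (s - c) ^+ 2 != 0 by rewrite expf_neq0// gt_eqF.
rewrite [X in _ --> X](_ : 1 = 3 * (s - c) ^+ 2 * ((s - c) ^+ 2)^-1 -
    2 * (s - c) * (s - c) ^+ 3 * ((s - c) ^+ 2) ^- 2); last first.
  by field; rewrite gt_eqF.
rewrite /ybase1 ppart_id ?ltW//; apply: cvgB; (apply: cvgM; first exact: cvg_cst).
  exact: cvgV.
exact: cvgVXn.
Qed.

Lemma cvg_prof s : c < s -> prof_ k s @[k --> \oo] --> A + B * s ^- n.
Proof.
move=> cs; apply: cvgD; first exact: cvg_cst.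
apply: cvgM; first exact: cvg_cst.
by apply: cvgVXn; [rewrite gt_eqF//; exact: lt_trans c0 _|exact: cvg_ybase].
Qed.

Lemma cvg_prof1 s : c < s ->
  prof1_ k s @[k --> \oo] --> - (n%:R * B * 1 * s ^- n.+1).
Proof.
move=> cs; apply: cvgN; apply: cvgM.
  by apply: cvgM; [exact: cvg_cst|exact: cvg_ybase1].
by apply: cvgVXn; [rewrite gt_eqF//; exact: lt_trans c0 _|exact: cvg_ybase].
Qed.

Lemma cvg_mode_density s :
  mode_density n (prof_ k) (prof1_ k) s @[k --> \oo] --> mode_density_lim s.
Proof.
rewrite /mode_density_lim; have [sc|cs] := leP s c.
  rewrite (_ : (fun k => _) = cst (s ^+ n.-1 * (n%:R * (A + B * c ^- n)) ^+ 2)).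
    exact: cvg_cst.
  apply/funext => k; have [h1 h2] := prof_in c n A B (eps k) s sc.
  by rewrite /mode_density h1 h2 /cst; ring.
have s0 : s != 0 by rewrite gt_eqF//; exact: lt_trans c0 _.
rewrite [X in _ --> X](_ : _ = s ^+ n.-1 * (
    (n%:R * (A + B * s ^- n) + s * - (n%:R * B * 1 * s ^- n.+1)) ^+ 2 +
    (s * - (n%:R * B * 1 * s ^- n.+1)) ^+ 2)); last first.
  congr (_ * _); rewrite [s ^+ n.+1]exprS; field.
  by rewrite s0 expf_neq0.
have sp1 : (s * prof1_ k s) @[k --> \oo] --> s * - (n%:R * B * 1 * s ^- n.+1).
  by apply: cvgM; [exact: cvg_cst|exact: cvg_prof1].
apply: cvgM; first exact: cvg_cst.
apply: cvgD; apply: cvgXn => //; apply: cvgD => //.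
by apply: cvgM; [exact: cvg_cst|exact: cvg_prof].
Qed.

Lemma mode_density_bound : exists K : R, forall k s, 0 <= s <= 1 ->
  `|mode_density n (prof_ k) (prof1_ k) s| <= K.
Proof.
pose K0 := `|A| + `|B| * c ^- n; pose K1 := n%:R * `|B| * 2 * c ^- n.+1.
(* Each constant bounds an absolute value, taken here at [eps = 1] and [s = 0]; neither depends on
   [eps]. *)
have K00 : 0 <= K0 by apply: le_trans (prof_bound c n A B c0 1 ltr01 0).
have K10 : 0 <= K1 by apply: le_trans (prof1_bound c n B c0 1 ltr01 0).
exists ((n%:R * K0 + K1) ^+ 2 + K1 ^+ 2) => k s /andP[s0 s1].
have e0 : 0 < eps k by exact: harmonic_gt0.
have h0 := prof_bound c n A B c0 _ e0 s; have h1 := prof1_bound c n B c0 _ e0 s.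
have hs : `|s * prof1_ k s| <= K1.
  rewrite normrM (ger0_norm s0) -[leRHS]mul1r ler_pM//.
have hn : `|n%:R * prof_ k s| <= n%:R * K0.
  by rewrite normrM (ger0_norm (ler0n R n)) ler_wpM2l.
rewrite /mode_density normrM -[leRHS]mul1r ler_pM//.
  by rewrite ger0_norm ?exprn_ge0// exprn_ile1.
rewrite (le_trans (ler_normD _ _))// !normrX.
apply: lerD; last by rewrite ler_sqr ?nnegrE.
rewrite ler_sqr ?nnegrE//; last by rewrite addr_ge0// mulr_ge0.
by rewrite (le_trans (ler_normD _ _))// lerD.
Qed.

Lemma measurable_mode_density k :
  measurable_fun setT (mode_density n (prof_ k) (prof1_ k)).
Proof.
have e0 : 0 < eps k by exact: harmonic_gt0.
have cp := derivable_continuous _ _ (is_derive_prof c n A B c0 _ e0).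
have cp1 := derivable_continuous _ _ (is_derive_prof1 c n B c0 _ e0).
exact: continuous_measurable_fun (continuous_mode_density n _ _ cp cp1).
Qed.

Lemma measurable_mode_density_lim : measurable_fun setT mode_density_lim.
Proof.
apply: (measurable_fun_cvg measurable_mode_density) => s _.
exact: cvg_mode_density.
Qed.

(** Dominated convergence. The integrability of the limit is recorded because the integral is later
    split at [c], where the integrand may jump. *)
Lemma cvg_weighted_density (W : R -> R) (M : R) : measurable_fun setT W ->
  (forall s, 0 <= s <= 1 -> `|W s| <= M) ->
  mu.-integrable `[0, 1] (EFin \o (fun s => W s * mode_density_lim s)) /\
  \int[mu]_(s in `[0, 1]) (W s * mode_density n (prof_ k) (prof1_ k) s)
    @[k --> \oo] --> \int[mu]_(s in `[0, 1]) (W s * mode_density_lim s).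
Proof.
move=> mW WM; have [K hK] := mode_density_bound.
have mf k : measurable_fun setT (fun s => W s * mode_density n (prof_ k) (prof1_ k) s).
  by apply: measurable_funM => //; exact: measurable_mode_density.
have cf s : (W s * mode_density n (prof_ k) (prof1_ k) s) @[k --> \oo] -->
    W s * mode_density_lim s.
  by apply: cvgM; [exact: cvg_cst|exact: cvg_mode_density].
have ml : measurable_fun setT (fun s => W s * mode_density_lim s).
  by apply: measurable_funM => //; exact: measurable_mode_density_lim.
have [] := @dominated_convergence _ (measurableTypeR R) R mu `[0, 1]%classic
  (measurable_itv _)
  (fun k s => (W s * mode_density n (prof_ k) (prof1_ k) s)%:E)
  (fun s => (W s * mode_density_lim s)%:E) (fun=> (M * K)%:E).
- by move=> k; apply/measurable_EFinP; apply: measurable_funTS; exact: (mf k).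
- by apply/measurable_EFinP; apply: measurable_funTS; exact: ml.
- by apply: aeW => s _; apply: cvg_EFin; [exact: nearW|exact: cf].
- exact: (continuous_integrable_itv (fun=> M * K) 0 1 (@cst_continuous _ _ _)).
- apply: aeW => s k /=; rewrite in_itv/= => s01; rewrite lee_fin normrM.
  by rewrite ler_pM//; [exact: WM|exact: hK].
move=> ifl _ cv; split; first exact: ifl.
apply: fine_cvg.
rewrite fineK//; exact: integrable_fin_num ifl.
Qed.

End profile_limit.

(** * Explicit integrals on both sides of the interface *)

Section explicit_integrals.
Context {R : realType}.
Notation mu := (@lebesgue_measure R).

(* As a function of [s = r^2].  Both the conductivity and an upper bound of its
   inverse, from [1 / (1 + y) <= 1 - y + y^2] with [y = alpha2 (a - r) / alpha1],
   have this form. *)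
Definition radial_weight (a w0 w1 w2 w3 s : R) : R :=
  if Num.sqrt s < a then
    w1 + w2 * (a - Num.sqrt s) + w3 * (a - Num.sqrt s) ^+ 2
  else w0.

Lemma sqrt_lt_sqr (a s : R) : 0 < a -> (Num.sqrt s < a) = (s < a ^+ 2).
Proof.
move=> a0; rewrite -[in LHS](ger0_norm (ltW a0)) -sqrtr_sqr ltr_sqrt//.
by rewrite exprn_gt0.
Qed.

Lemma measurable_radial_weight a w0 w1 w2 w3 :
  measurable_fun setT (radial_weight a w0 w1 w2 w3).
Proof.
have ms : measurable_fun setT (@Num.sqrt R).
  exact: continuous_measurable_fun (@sqrt_continuous R).
have mas : measurable_fun setT (fun s : R => a - Num.sqrt s).
  by apply: measurable_funB => //; exact: measurable_cst.
apply: measurable_fun_ifT.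
- by apply: measurable_fun_ltr => //; exact: measurable_cst.
- apply: measurable_funD; last first.
    apply: measurable_funM; first exact: measurable_cst.
    exact: measurable_funX.
  apply: measurable_funD; first exact: measurable_cst.
  by apply: measurable_funM => //; exact: measurable_cst.
- exact: measurable_cst.
Qed.

(** The square root is not differentiable at 0, so the antiderivative is differentiated on the open
    interval only, with continuity at the ends. *)
Lemma Rintegral_inner_density (a w1 w2 w3 H : R) n : 0 < a -> (0 < n)%N ->
  \int[mu]_(s in `[0, a ^+ 2]) (H * s ^+ n.-1 *
    (w1 + w2 * (a - Num.sqrt s) + w3 * (a - Num.sqrt s) ^+ 2)) =
  H * a ^+ (2 * n) / n%:R *
    (w1 + w2 * a / (2 * n%:R + 1) + w3 * a ^+ 2 / ((2 * n%:R + 1) * (n%:R + 1))).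
Proof.
move=> a0; case: n => // m _; rewrite -[m.+1.-1]/m.
have c0 : 0 < a ^+ 2 by rewrite exprn_gt0.
have cs : continuous (@Num.sqrt R) by exact: sqrt_continuous.
have cas : continuous (fun s : R => a - Num.sqrt s).
  by move=> s; apply: cvgB; [exact: cvg_cst|exact: cs].
pose f s := H * s ^+ m *
  (w1 + w2 * (a - Num.sqrt s) + w3 * (a - Num.sqrt s) ^+ 2).
have cf : continuous f.
  move=> s; apply: cvgM.
    by apply: cvgM; [exact: cvg_cst|exact: exprn_continuous].
  apply: cvgD; last first.
    by apply: cvgM; [exact: cvg_cst|apply: cvgM; exact: cas].
  apply: cvgD; first exact: cvg_cst.
  by apply: cvgM; [exact: cvg_cst|exact: cas].
(* In powers of [q = sqrt s] the weight is [k1 - k2 q + w3 q^2]. *)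
pose k1 := w1 + w2 * a + w3 * a ^+ 2.
pose k2 := w2 + 2 * a * w3.
have m1 : m.+1%:R != 0 :> R by rewrite pnatr_eq0.
have m2 : m.+1%:R + 1 != 0 :> R by rewrite natr1 pnatr_eq0.
have m3 : 2 * m.+1%:R + 1 != 0 :> R by rewrite -natrM natr1 pnatr_eq0.
pose F s := H * (k1 / m.+1%:R * s ^+ m.+1 + w3 / (m.+1%:R + 1) * s ^+ m.+2 -
  2 * k2 / (2 * m.+1%:R + 1) * (s ^+ m.+1 * Num.sqrt s)).
have cF : continuous F.
  move=> s; apply: cvgM; first exact: cvg_cst.
  apply: cvgB.
    by apply: cvgD; apply: cvgM; try exact: cvg_cst; exact: exprn_continuous.
  apply: cvgM; first exact: cvg_cst.
  by apply: cvgM; [exact: exprn_continuous|exact: cs].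
have dF (s : R) : 0 < s -> is_derive s 1 F (f s).
  move=> s0.
  have dX k : is_derive s 1 (fun s => s ^+ k.+1) (k.+1%:R * s ^+ k).
    by have := is_deriveX k.+1 (is_derive_id s 1); rewrite exprfctE /GRing.scale/= mulr1.
  have h1 := dX m; have h2 := dX m.+1; have h3 := is_derive1_sqrt s0.
  have q0 : Num.sqrt s != 0 by rewrite gt_eqF// sqrtr_gt0.
  apply: is_derive_eq; rewrite /GRing.scale/= /f /k1 /k2.
  have -> : m.+2%:R = m.+1%:R + 1 :> R by rewrite natr1.
  have sE : s = Num.sqrt s ^+ 2 by rewrite sqr_sqrtr// ltW.
  rewrite !exprS expr0; move: m1 m2 m3; move: (m.+1%:R) => M m1 m2 m3.
  move: (s ^+ m) sE q0; move: (Num.sqrt s) => q X -> q0.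
  by field; rewrite m1 m2 m3 q0.
rewrite /Rintegral (continuous_FTC2 (f := f) (F := F))//.
- rewrite /= /F sqrtr_sqr (ger0_norm (ltW a0)) !expr0n/=.
  rewrite !mul0r !mulr0 !addr0 subr0 mulr0 subr0.
  rewrite -!exprM.
  have -> : a ^+ (2 * m.+2) = a ^+ (2 * m.+1) * a ^+ 2.
    by rewrite -exprD; congr (_ ^+ _); rewrite mulnS addnC.
  rewrite /k1 /k2; move: m1 m2 m3; move: (m.+1%:R : R) => M m1 m2 m3.
  by field; rewrite m1 m2 m3.
- exact: continuous_subspaceT.
- split.
  + by move=> s; rewrite in_itv/= => /andP[s0 _]; have [] := dF s s0.
  + by apply: cvg_at_right_filter; exact: cF.
  + by apply: cvg_at_left_filter; exact: cF.
- by move=> s; rewrite in_itv/= => /andP[s0 _]; rewrite derive1E; have [] := dF s s0.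
Qed.

Lemma Rintegral_outer_density (c w0 A B : R) n : 0 < c -> c < 1 -> (0 < n)%N ->
  \int[mu]_(s in `[c, 1]) (w0 * s ^+ n.-1 *
     ((n%:R * A) ^+ 2 + (n%:R * B * s ^- n) ^+ 2)) =
  n%:R * w0 * (A ^+ 2 * (1 - c ^+ n) + B ^+ 2 * (c ^- n - 1)).
Proof.
move=> c0 c1; case: n => // m _; rewrite -[m.+1.-1]/m.
pose f s := w0 * s ^+ m * ((m.+1%:R * A) ^+ 2 + (m.+1%:R * B * s ^- m.+1) ^+ 2).
have cVX (s : R) : 0 < s -> {for s, continuous (fun s : R => s ^- m.+1)}.
  move=> s0; apply: cvgV; first by rewrite expf_neq0// gt_eqF.
  exact: exprn_continuous.
have cf (s : R) : 0 < s -> {for s, continuous f}.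
  move=> s0; apply: cvgM.
    by apply: cvgM; [exact: cvg_cst|exact: exprn_continuous].
  apply: cvgD; first exact: cvg_cst.
  by apply: cvgM; (apply: cvgM; [exact: cvg_cst|exact: cVX]).
pose F s := m.+1%:R * w0 * (A ^+ 2 * s ^+ m.+1 - B ^+ 2 * s ^- m.+1).
have cF (s : R) : 0 < s -> {for s, continuous F}.
  move=> s0; apply: cvgM; first exact: cvg_cst.
  apply: cvgB; apply: cvgM; try exact: cvg_cst; [exact: exprn_continuous|exact: cVX].
have dF (s : R) : 0 < s -> is_derive s 1 F (f s).
  move=> s0.
  have sN0 : s != 0 by rewrite gt_eqF.
  have h1 : is_derive s 1 (fun s => s ^+ m.+1) (m.+1%:R * s ^+ m).
    by have := is_deriveX m.+1 (is_derive_id s 1); rewrite exprfctE /GRing.scale/= mulr1.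
  have h2 := @is_deriveV _ (fun s => s ^+ m.+1) s _ 1 (expf_neq0 m.+1 sN0) h1.
  apply: is_derive_eq; rewrite /GRing.scale/= /f !exprS expr0.
  by field; rewrite sN0 expf_neq0.
rewrite /Rintegral (continuous_FTC2 (f := f) (F := F))//.
- by rewrite /= /F !expr1n invr1; ring.
- apply: continuous_in_subspaceT => s; rewrite inE/= in_itv/= => /andP[s0 _].
  by apply: cf; exact: lt_le_trans c0 s0.
- split.
  + move=> s; rewrite in_itv/= => /andP[s0 _].
    by have [] := dF s (lt_trans c0 s0).
  + by apply: cvg_at_right_filter; exact: cF.
  + by apply: cvg_at_left_filter; exact: cF.
- move=> s; rewrite in_itv/= => /andP[s0 _]; rewrite derive1E.
  by have [] := dF s (lt_trans c0 s0).
Qed.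

End explicit_integrals.

(** * Explicit bounds for each eigenvalue *)

Section mode_bounds.
Context {R : realType}.
Notation mu := (@lebesgue_measure R).

(* The limit energy, divided by [n], of the profile [A + B s^-n] frozen at its
   value in [a^2] inside, when the weight is [w0] outside and has weighted mean
   [v] inside. *)
Definition mode_energy (a w0 v A B : R) (n : nat) : R :=
  w0 * (A ^+ 2 * (1 - a ^+ (2 * n)) + B ^+ 2 * (a ^- (2 * n) - 1)) +
  (A + B * a ^- (2 * n)) ^+ 2 * a ^+ (2 * n) * v.

(** The mean of the inner weight for the probability density [n s^(n-1) / a^(2n)] on [[0, a^2]]. *)
Definition inner_weight (a w1 w2 w3 : R) (n : nat) : R :=
  w1 + w2 * a / (2 * n%:R + 1) + w3 * a ^+ 2 / ((2 * n%:R + 1) * (n%:R + 1)).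

Lemma Rintegral_mode_density_lim (a w0 w1 w2 w3 A B : R) n :
  0 < a < 1 -> (0 < n)%N ->
  mu.-integrable `[0, 1] (EFin \o (fun s =>
    radial_weight a w0 w1 w2 w3 s * mode_density_lim (a ^+ 2) n A B s)) ->
  \int[mu]_(s in `[0, 1])
    (radial_weight a w0 w1 w2 w3 s * mode_density_lim (a ^+ 2) n A B s) =
  n%:R * mode_energy a w0 (inner_weight a w1 w2 w3 n) A B n.
Proof.
move=> /andP[a0 a1] n0 ig; have c0 : 0 < a ^+ 2 by rewrite exprn_gt0.
have c1 : a ^+ 2 < 1 by rewrite exprn_ilt1// ltW.
have nN0 : n%:R != 0 :> R by rewrite pnatr_eq0 -lt0n.
have n1 : n%:R + 1 != 0 :> R by rewrite natr1 pnatr_eq0.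
have n2 : 2 * n%:R + 1 != 0 :> R by rewrite -natrM natr1 pnatr_eq0.
have mW := measurable_radial_weight a w0 w1 w2 w3.
have md := measurable_mode_density_lim (a ^+ 2) n A B c0.
have mg := measurable_funM mW md.
rewrite -(integrable_Rintegral_itv_cat _ _ (a ^+ 2) _ ig) ?ltW//.
pose H := (n%:R * (A + B * a ^- (2 * n))) ^+ 2.
have -> : \int[mu]_(s in `[0, a ^+ 2])
    (radial_weight a w0 w1 w2 w3 s * mode_density_lim (a ^+ 2) n A B s) =
  \int[mu]_(s in `[0, a ^+ 2]) (H * s ^+ n.-1 *
    (w1 + w2 * (a - Num.sqrt s) + w3 * (a - Num.sqrt s) ^+ 2)).
  apply: eq_Rintegral_itvoo => //.
  move=> s /andP[s0 sc]; rewrite /radial_weight sqrt_lt_sqr// sc.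
  by rewrite /mode_density_lim (ltW sc) -exprM /H; ring.
have -> : \int[mu]_(s in `[a ^+ 2, 1])
    (radial_weight a w0 w1 w2 w3 s * mode_density_lim (a ^+ 2) n A B s) =
  \int[mu]_(s in `[a ^+ 2, 1]) (w0 * s ^+ n.-1 *
     ((n%:R * A) ^+ 2 + (n%:R * B * s ^- n) ^+ 2)).
  apply: eq_Rintegral_itvoo => // s /andP[sc s1].
  rewrite /radial_weight sqrt_lt_sqr// ltNge (ltW sc) /=.
  by rewrite /mode_density_lim leNgt sc /=; ring.
rewrite Rintegral_inner_density// Rintegral_outer_density// -!exprM.
rewrite /mode_energy /inner_weight /H.
have X0 : a ^+ (2 * n) != 0 by rewrite expf_neq0// gt_eqF.
move: (a ^+ (2 * n)) X0 => X X0.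
by field; rewrite X0 nN0 n1 n2.
Qed.

(** As [G] is nonnegative on the half-line only, the formula for extended integrals is applied to
    [|G|]. *)
Lemma Rintegral_disc_radial (G : R -> R) : measurable_fun setT G ->
  (forall s, 0 <= s -> 0 <= G s) ->
  \int[leb2]_(x in @disc R) G (nsq x) = pi * \int[mu]_(s in `[0, 1]) G s.
Proof.
move=> mG G0.
have E : (\int[leb2]_(x in @disc R) (`|G (nsq x)|)%:E =
    pi%:E * \int[mu]_(s in `[0%R, 1%R]) (`|G s|)%:E)%E.
  by apply: (integral_disc_radial (fun s => `|G s|)) => //; exact: measurableT_comp.
have -> : \int[leb2]_(x in @disc R) G (nsq x) =
    \int[leb2]_(x in @disc R) `|G (nsq x)|.
  by apply: eq_Rintegral => x _; rewrite ger0_norm// G0// nsq_ge0.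
rewrite /Rintegral E.
have -> : (\int[mu]_(s in `[0%R, 1%R]) (`|G s|)%:E =
    \int[mu]_(s in `[0%R, 1%R]) (G s)%:E)%E.
  apply: eq_integral => s; rewrite inE/= in_itv/= => /andP[s0 _].
  by rewrite ger0_norm// G0.
have [fI|] := boolP ((\int[mu]_(s in `[0%R, 1%R]) (G s)%:E)%E \is a fin_num).
  by rewrite -(fineK fI) -EFinM.
rewrite ge0_fin_numE; last first.
  apply: integral_ge0 => s /=; rewrite in_itv/= => /andP[s0 _].
  by rewrite lee_fin G0.
(* An infinite integral has the real value 0 by convention, on both sides. *)
rewrite -leNgt leye_eq => /eqP ->.
by rewrite gt0_muley ?lte_fin ?pi_gt0//= mulr0.
Qed.

Lemma integrable_weight_continuous w (f : R * R -> R) : weight w -> continuous f ->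
  leb2.-integrable (@disc R) (EFin \o (fun x => w x * f x)).
Proof.
move=> [mw [lo [hi [lo0 hb]]]] cf.
have wM x : @disc R x -> `|w x| <= hi.
  by move=> /hb /andP[l1 l2]; rewrite ger0_norm//; lra.
have mD := @measurable_disc R.
have wf := L2_mul_bounded (m := (mu \x mu)%E) mD _ _ _ mw wM
  (continuous_L2_disc _ cf).
have c1 : continuous (fun _ : R * R => 1 : R) by exact: cst_continuous.
have I := L2_integrable_mul (m := (mu \x mu)%E) mD _ _ wf (continuous_L2_disc _ c1).
apply: (eq_integrable (mu := (mu \x mu)%E) mD _ _ _ I) => x _.
by rewrite /= mulr1.
Qed.

Section radial_weights.
Variables (a w0 w1 w2 w3 lo hi : R).
Hypotheses (a01 : 0 < a < 1) (lo0 : 0 < lo).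
Hypothesis Wb : forall s, lo <= radial_weight a w0 w1 w2 w3 s <= hi.
Local Notation W := (radial_weight a w0 w1 w2 w3).

Lemma weight_radial : weight (fun x => W (nsq x)).
Proof.
split; last by exists lo, hi; split=> // x _; exact: Wb.
apply: measurable_funTS; apply: measurableT_comp; last exact: measurable_nsq.
exact: measurable_radial_weight.
Qed.

Lemma Rintegral_disc_weighted n (e e' : R -> R) : continuous e -> continuous e' ->
  \int[leb2]_(x in @disc R) (W (nsq x) * mode_density n e e' (nsq x)) =
  pi * \int[mu]_(s in `[0, 1]) (W s * mode_density n e e' s).
Proof.
move=> ce ce'; apply: (Rintegral_disc_radial (fun s => W s * mode_density n e e' s)).
  apply: measurable_funM; first exact: measurable_radial_weight.
  exact: continuous_measurable_fun (continuous_mode_density n _ _ ce ce').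
move=> s s0; apply: mulr_ge0; last exact: mode_density_ge0.
by have /andP[h _] := Wb s; apply: le_trans h; exact: ltW.
Qed.

Lemma cvg_mode_energy n A B : (0 < n)%N ->
  \int[mu]_(s in `[0, 1]) (W s * mode_density n (prof (a ^+ 2) n A B (@harmonic R k))
    (prof1 (a ^+ 2) n B (@harmonic R k)) s) @[k --> \oo] -->
  n%:R * mode_energy a w0 (inner_weight a w1 w2 w3 n) A B n.
Proof.
move=> n0; have /andP[a0 _] := a01.
have [] := cvg_weighted_density (a ^+ 2) n A B (exprn_gt0 2 a0) W hi
  (measurable_radial_weight a w0 w1 w2 w3).
  move=> s _; have /andP[h1 h2] := Wb s.
  by rewrite ger0_norm// (le_trans _ h1)// ltW.
by move=> ig; rewrite Rintegral_mode_density_lim.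
Qed.

End radial_weights.

(** Both principles are written for the regularized profiles and passed to the limit. In the dual
    one the inverse conductivity is first replaced by its majorant [W'], whose integrals are
    explicit. *)
Lemma conductivity_mode_bounds (a al0 al1 al2 : R) n (c : R[i]) :
  0 < a < 1 -> 0 < al0 -> 0 < al1 -> 0 <= al2 -> (0 < n)%N ->
  is_DNC (conductivity a al0 al1 al2) (expi n)
    (functional_of (fun t : R => c * n%:R * expi n t)%C) ->
  exists p : R, c = p%:C%C /\ forall A B,
    p * (A + B) ^+ 2 <= mode_energy a al0 (inner_weight a al1 al2 0 n) A B n /\
    2 * (A + B) - p <= mode_energy a al0^-1 (inner_weight a al1^-1
      (- (al2 / al1 ^+ 2)) (al2 ^+ 2 / al1 ^+ 3) n) A B n.
Proof.
move=> a01 al00 al10 al20 n0 hc; have /andP[a0 a1] := a01.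
pose W := radial_weight a al0 al1 al2 0.
pose W' := radial_weight a al0^-1 al1^-1 (- (al2 / al1 ^+ 2)) (al2 ^+ 2 / al1 ^+ 3).
have gamE : conductivity a al0 al1 al2 = fun x => W (nsq x).
  by apply/funext => x; rewrite /conductivity /W /radial_weight mul0r addr0.
have lo0 : 0 < Num.min al0 al1 by rewrite lt_min al00.
have Wb s : Num.min al0 al1 <= W s <= al0 + al1 + al2 * a.
  have q0 := sqrtr_ge0 s; rewrite /W /radial_weight mul0r addr0.
  have aa : 0 <= al2 * a by rewrite mulr_ge0// ltW.
  case: ifPn => [sa|_].
    have y0 : 0 <= al2 * (a - Num.sqrt s) by rewrite mulr_ge0//; lra.
    have y1 : 0 <= al2 * Num.sqrt s by rewrite mulr_ge0.
    by rewrite ge_min; apply/andP; split; [apply/orP; right|]; lra.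
  by rewrite ge_min lexx/=; lra.
(* The factor [3 / 4] is the minimum of [1 - y + y^2]. *)
have lo0' : 0 < Num.min al0^-1 ((4 / 3)^-1 * al1^-1).
  by rewrite lt_min invr_gt0 al00/= mulr_gt0 ?invr_gt0.
have Wb' s : Num.min al0^-1 ((4 / 3)^-1 * al1^-1) <= W' s <=
    al0^-1 + al1^-1 * (1 + (al2 * a / al1) ^+ 2).
  have q0 := sqrtr_ge0 s; rewrite /W' /radial_weight.
  have i1 : 0 < al1^-1 by rewrite invr_gt0.
  have i0 : 0 < al0^-1 by rewrite invr_gt0.
  case: ifPn => [sa|_].
    pose y := al2 * (a - Num.sqrt s) / al1.
    have -> : al1^-1 + - (al2 / al1 ^+ 2) * (a - Num.sqrt s) +
        al2 ^+ 2 / al1 ^+ 3 * (a - Num.sqrt s) ^+ 2 = al1^-1 * (1 - y + y ^+ 2).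
      by rewrite /y; field; rewrite gt_eqF.
    have y0 : 0 <= y by rewrite divr_ge0 ?mulr_ge0//; lra.
    have yk : y <= al2 * a / al1.
      rewrite ler_pM2r// ler_wpM2l//; lra.
    rewrite ge_min; apply/andP; split.
      apply/orP; right; rewrite mulrC ler_pM2l//.
      have := sqr_ge0 (y - 2^-1); lra.
    rewrite ler_wpDl ?(ltW i0)// ler_pM2l//.
    move: yk; set z := al2 * a / al1 => yk; nra.
  rewrite ge_min lexx/= lerDl mulr_ge0 ?(ltW i1)// addr_ge0// sqr_ge0//.
have WW' s : (W s)^-1 <= W' s.
  have q0 := sqrtr_ge0 s; rewrite /W /W' /radial_weight.
  case: ifPn => [sa|_] //.
  rewrite mul0r addr0.
  have y0 : 0 <= al2 * (a - Num.sqrt s) by rewrite mulr_ge0//; lra.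
  have -> : - (al2 / al1 ^+ 2) * (a - Num.sqrt s) = - (al2 * (a - Num.sqrt s) / al1 ^+ 2).
    by ring.
  have -> : al2 ^+ 2 / al1 ^+ 3 * (a - Num.sqrt s) ^+ 2 =
      (al2 * (a - Num.sqrt s)) ^+ 2 / al1 ^+ 3.
    by ring.
  move: (al2 * _) y0 => y y0.
  have d0 : 0 < al1 + y by lra.
  rewrite -subr_ge0.
  (* The geometric expansion of [1 / (al1 + y)] is cut after its quadratic term; the remainder has a
     sign because [y >= 0]. *)
  have -> : al1^-1 + - (y / al1 ^+ 2) + y ^+ 2 / al1 ^+ 3 - (al1 + y)^-1 =
      y ^+ 3 / (al1 ^+ 3 * (al1 + y)).
    by field; rewrite !gt_eqF.
  by rewrite divr_ge0 ?mulr_ge0 ?exprn_ge0// ltW.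
have hW : weight (conductivity a al0 al1 al2).
  by rewrite gamE; exact: weight_radial lo0 Wb.
have hW' := weight_radial _ _ _ _ _ _ _ lo0' Wb'.
have [p [cp hp]] := dn_energy_bounds _ _ _ hW n0 hc.
exists p; split=> // A B.
have cc0 : 0 < a ^+ 2 by rewrite exprn_gt0.
have c1 : a ^+ 2 < 1 by rewrite exprn_ilt1// ltW.
pose e k := prof (a ^+ 2) n A B (@harmonic R k).
pose e' k := prof1 (a ^+ 2) n B (@harmonic R k).
have de k s := is_derive_prof (a ^+ 2) n A B cc0 _ (harmonic_gt0 k) s.
have de' k s := is_derive_prof1 (a ^+ 2) n B cc0 _ (harmonic_gt0 k) s.
have ce k := derivable_continuous _ _ (de k).
have ce' k := derivable_continuous _ _ (de' k).
have nR : 0 < n%:R :> R by rewrite ltr0n.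
have pi0 := pi_gt0 R.
have bk k : p * n%:R * e k 1 ^+ 2 <=
      \int[mu]_(s in `[0, 1]) (W s * mode_density n (e k) (e' k) s) /\
    n%:R * (2 * e k 1 - p) <=
      \int[mu]_(s in `[0, 1]) (W' s * mode_density n (e k) (e' k) s).
  have [h1 h2] := hp _ _ _ (de k) (de' k)
    (continuous_prof2 (a ^+ 2) n B cc0 _ (harmonic_gt0 k)).
  split.
    rewrite -(ler_pM2r pi0); apply: (le_trans h1).
    rewrite gamE (Rintegral_disc_weighted _ _ _ _ _ _ _ lo0 Wb n _ _ (ce k) (ce' k)).
    by rewrite mulrC.
  rewrite -(ler_pM2r pi0); apply: (le_trans h2).
  rewrite [leRHS]mulrC.
  rewrite -(Rintegral_disc_weighted _ _ _ _ _ _ _ lo0' Wb' n _ _ (ce k) (ce' k)).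
  have cmd : continuous (fun x => mode_density n (e k) (e' k) (nsq x)).
    move=> x; apply: (@continuous_comp _ _ _ (@nsq R) (mode_density n (e k) (e' k))).
      exact: continuous_nsq.
    exact: (continuous_mode_density n _ _ (ce k) (ce' k)).
  apply: le_Rintegral.
  - exact: measurable_disc.
  - exact: (integrable_weight_continuous _ _ (weight_inv _ hW) cmd).
  - exact: (integrable_weight_continuous _ _ hW' cmd).
  - move=> x _; apply: ler_wpM2r; first exact/mode_density_ge0/nsq_ge0.
    by rewrite gamE; exact: WW'.
have e1 : e k 1 @[k --> \oo] --> A + B.
  have := cvg_prof (a ^+ 2) n A B cc0 1 c1.
  by rewrite expr1n invr1 mulr1.
have I1 := cvg_mode_energy _ _ _ _ _ _ _ a01 lo0 Wb n A B n0.
have I2 := cvg_mode_energy _ _ _ _ _ _ _ a01 lo0' Wb' n A B n0.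
split.
  rewrite -(ler_pM2l nR).
  have h : (p * n%:R * e k 1 ^+ 2) @[k --> \oo] --> n%:R * (p * (A + B) ^+ 2).
    rewrite [X in _ --> X](_ : _ = p * n%:R * (A + B) ^+ 2); last by ring.
    by apply: cvgM; [exact: cvg_cst|apply: cvgM].
  by apply: (ler_cvg_to h I1); apply: nearW => k; have [] := bk k.
rewrite -(ler_pM2l nR).
have h : (n%:R * (2 * e k 1 - p)) @[k --> \oo] --> n%:R * (2 * (A + B) - p).
  apply: cvgM; first exact: cvg_cst.
  apply: cvgB; last exact: cvg_cst.
  by apply: cvgM; first exact: cvg_cst.
by apply: (ler_cvg_to h I2); apply: nearW => k; have [] := bk k.
Qed.

End mode_bounds.

(** * Asymptotics of the eigenvalues *)

Section asymptotics.
Context {R : realType}.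

Lemma inner_weight_upper (a al1 al2 : R) n : al1 != 0 ->
  inner_weight a al1 al2 0 n = al1 * (1 + al2 * a / al1 / (2 * n%:R + 1)).
Proof.
move=> h1; have h2 : 2 * n%:R + 1 != 0 :> R by rewrite -natrM natr1 pnatr_eq0.
have h3 : n%:R + 1 != 0 :> R by rewrite natr1 pnatr_eq0.
by rewrite /inner_weight; field; rewrite h1 h2 h3.
Qed.

Lemma inner_weight_lower (a al1 al2 : R) n : al1 != 0 ->
  inner_weight a al1^-1 (- (al2 / al1 ^+ 2)) (al2 ^+ 2 / al1 ^+ 3) n =
  al1^-1 * (1 - (al2 * a / al1 / (2 * n%:R + 1) -
    (al2 * a / al1) ^+ 2 / ((2 * n%:R + 1) * (n%:R + 1)))).
Proof.
move=> h1; have h2 : 2 * n%:R + 1 != 0 :> R by rewrite -natrM natr1 pnatr_eq0.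
have h3 : n%:R + 1 != 0 :> R by rewrite natr1 pnatr_eq0.
by rewrite /inner_weight; field; rewrite h1 h2 h3.
Qed.

(* Here and in [mode_energy_lower], the proof takes the optimal [A] and [B]. *)
Lemma mode_energy_upper (a al0 v p : R) n : 0 < a < 1 -> 0 < al0 -> 0 < v ->
  (forall A B, p * (A + B) ^+ 2 <= mode_energy a al0 v A B n) ->
  al0 * (2 * al0 * a ^+ (2 * n) + (p - al0) * (1 + a ^+ (2 * n))) <=
  v * (2 * al0 * a ^+ (2 * n) - (p - al0) * (1 - a ^+ (2 * n))).
Proof.
move=> /andP[a0 a1] al00 v0 h.
have X0 : 0 < a ^+ (2 * n) by rewrite exprn_gt0.
have X1 : a ^+ (2 * n) <= 1 by rewrite exprn_ile1// ltW.
(* With [X = a^(2n)], these [A] and [B] satisfy [al0 (A - B / X) = v (A + B / X)]: the flux is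
   continuous across [r = a] for a core of constant conductivity [v]. *)
have := h (al0 + v) (a ^+ (2 * n) * (al0 - v)).
rewrite /mode_energy; move: (a ^+ (2 * n)) X0 X1 => X X0 X1.
have -> : al0 * ((al0 + v) ^+ 2 * (1 - X) + (X * (al0 - v)) ^+ 2 * (X^-1 - 1)) +
    (al0 + v + X * (al0 - v) * X^-1) ^+ 2 * X * v =
    al0 * (al0 + v - X * (al0 - v)) * (al0 + v + X * (al0 - v)).
  by field; rewrite gt_eqF.
rewrite expr2 mulrA ler_pM2r; last by nra.
by move=> {}h; nra.
Qed.

Lemma mode_energy_lower (a al0 v p : R) n : 0 < a < 1 -> 0 < al0 -> 0 < v ->
  (forall A B, 2 * (A + B) - p <= mode_energy a al0^-1 v A B n) ->
  2 * al0 * a ^+ (2 * n) - (p - al0) * (1 - a ^+ (2 * n)) <=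
  al0 * v * (2 * al0 * a ^+ (2 * n) + (p - al0) * (1 + a ^+ (2 * n))).
Proof.
move=> /andP[a0 a1] al00 v0 h.
have X0 : 0 < a ^+ (2 * n) by rewrite exprn_gt0.
have X1 : a ^+ (2 * n) <= 1 by rewrite exprn_ile1// ltW.
pose D := 1 + al0 * v - a ^+ (2 * n) * (1 - al0 * v).
have av0 : 0 < al0 * v by rewrite mulr_gt0.
have D0 : 0 < D by rewrite /D; move: (a ^+ _) X0 X1 (al0 * v) av0 => X X0 X1 y y0; nra.
(* The same matching with weights [1 / al0] outside and [v] inside. The factor [al0 / D] is the
   scaling that makes the energy equal to [A + B], where [2 (A + B)] minus the energy is largest
   among multiples. *)
have := h (al0 * (1 + al0 * v) / D) (al0 * (a ^+ (2 * n) * (1 - al0 * v)) / D).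
have -> : mode_energy a al0^-1 v (al0 * (1 + al0 * v) / D)
    (al0 * (a ^+ (2 * n) * (1 - al0 * v)) / D) n =
    al0 * (1 + al0 * v + a ^+ (2 * n) * (1 - al0 * v)) / D.
  move: (D0); rewrite /mode_energy /D; move: (a ^+ _) X0 X1 => X X0 X1 D0'.
  by field; rewrite !gt_eqF.
have -> : 2 * (al0 * (1 + al0 * v) / D + al0 * (a ^+ (2 * n) * (1 - al0 * v)) / D) =
    2 * (al0 * (1 + al0 * v + a ^+ (2 * n) * (1 - al0 * v)) / D).
  by field; rewrite gt_eqF.
move=> {}h.
have {h} : al0 * (1 + al0 * v + a ^+ (2 * n) * (1 - al0 * v)) / D <= p by lra.
rewrite ler_pdivrMr// /D; move: (a ^+ _) X0 X1 => X X0 X1 h; nra.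
Qed.

(** A homogeneous core of conductivity [al1 * b] would have the eigenvalue [p]. Dirichlet's
    principle bounds [b] by the mean of the conductivity, Thomson's by the inverse of a mean; the
    last identity inverts the homographic relation between [b] and [p]. *)
Lemma ratio_bounds (a al0 al1 al2 p : R) n : 0 < a < 1 -> 0 < al0 -> 0 < al1 ->
  0 <= al2 ->
  (forall A B,
    p * (A + B) ^+ 2 <= mode_energy a al0 (inner_weight a al1 al2 0 n) A B n /\
    2 * (A + B) - p <= mode_energy a al0^-1 (inner_weight a al1^-1
      (- (al2 / al1 ^+ 2)) (al2 ^+ 2 / al1 ^+ 3) n) A B n) ->
  let k := al2 * a / al1 in
  let b := (al0 * (2 * al0 * a ^+ (2 * n) + (p - al0) * (1 + a ^+ (2 * n)))) /
    (al1 * (2 * al0 * a ^+ (2 * n) - (p - al0) * (1 - a ^+ (2 * n)))) in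
  [/\ 0 < b, k - k ^+ 2 / (n%:R + 1) <= (2 * n%:R + 1) * (b - 1) <= k &
      p - al0 = 2 * al0 * a ^+ (2 * n) *
        ((al1 / al0 * b - 1) /
         ((1 + al1 / al0 * b) + a ^+ (2 * n) * (1 - al1 / al0 * b)))].
Proof.
move=> a01 al00 al10 al20 h k b; have /andP[a0 a1] := a01.
have k0 : 0 <= k by rewrite divr_ge0 ?mulr_ge0// ltW.
have X0 : 0 < a ^+ (2 * n) by rewrite exprn_gt0.
have X1 : a ^+ (2 * n) <= 1 by rewrite exprn_ile1// ltW.
have n0 : 0 <= n%:R :> R by [].
have m0 : 0 < 2 * n%:R + 1 :> R by lra.
have m1 : 0 < n%:R + 1 :> R by lra.
pose z := k / (2 * n%:R + 1) - k ^+ 2 / ((2 * n%:R + 1) * (n%:R + 1)).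
have zE : (2 * n%:R + 1) * z = k - k ^+ 2 / (n%:R + 1).
  by rewrite /z; field; rewrite !gt_eqF.
(* Over all [k], the largest value of [k - k^2 / (n + 1)] is [(n + 1) / 4], which is below
   [2n + 1]. *)
have z1 : z < 1.
  rewrite -(ltr_pM2l m0) zE mulr1.
  have : k - k ^+ 2 / (n%:R + 1) <= (n%:R + 1) / 4.
    rewrite -(ler_pM2r m1) mulrBl divfK ?gt_eqF//.
    have := sqr_ge0 (k - (n%:R + 1) / 2); nra.
  lra.
have hu : 0 < inner_weight a al1 al2 0 n.
  rewrite inner_weight_upper ?gt_eqF// mulr_gt0// ltr_pwDl// divr_ge0// ltW//.
have hl : 0 < inner_weight a al1^-1 (- (al2 / al1 ^+ 2)) (al2 ^+ 2 / al1 ^+ 3) n.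
  rewrite inner_weight_lower ?gt_eqF// mulr_gt0 ?invr_gt0// -/k -/z; lra.
have U := mode_energy_upper _ _ _ _ _ a01 al00 hu (fun A B => (h A B).1).
have L := mode_energy_lower _ _ _ _ _ a01 al00 hl (fun A B => (h A B).2).
rewrite inner_weight_upper ?gt_eqF// -/k in U.
rewrite inner_weight_lower ?gt_eqF// -/k -/z in L.
set Nn := 2 * al0 * a ^+ (2 * n) + _ in b U L *.
set Dn := 2 * al0 * a ^+ (2 * n) - _ in b U L *.
have S : Nn * (1 - a ^+ (2 * n)) + Dn * (1 + a ^+ (2 * n)) = 4 * al0 * a ^+ (2 * n).
  by rewrite /Nn /Dn; ring.
have SX : 0 < 4 * al0 * a ^+ (2 * n) by rewrite !mulr_gt0.
(* By [U], [Dn <= 0] would force [Nn <= 0], but [S] combines them with nonnegative coefficients into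
   a positive number. *)
have D0 : 0 < Dn.
  rewrite ltNge; apply/negP => D0.
  have v0 : 0 < al1 * (1 + k / (2 * n%:R + 1)).
    by rewrite mulr_gt0// ltr_pwDl// divr_ge0// ltW.
  have Nle : Nn <= 0.
    rewrite -(pmulr_rle0 _ al00); apply: (le_trans U).
    by rewrite pmulr_rle0.
  have : 0 < Nn * (1 - a ^+ (2 * n)) + Dn * (1 + a ^+ (2 * n)) by rewrite S.
  by move: (a ^+ (2 * n)) X0 X1 => X X0 X1; nra.
have z1' : 0 < 1 - z by lra.
have N0 : 0 < Nn.
  have l0 : 0 < al0 * (al1^-1 * (1 - z)) by rewrite !mulr_gt0// invr_gt0.
  by rewrite -(pmulr_rgt0 _ l0); apply: lt_le_trans L.
have bE : b = al0 * Nn / (al1 * Dn) by [].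
have b_le : b <= 1 + k / (2 * n%:R + 1).
  rewrite bE ler_pdivrMr ?mulr_gt0//; move: U; lra.
have b_ge : 1 <= b * (1 - z).
  rewrite bE mulrAC ler_pdivlMr ?mulr_gt0// mul1r.
  rewrite -(ler_pM2l al10) in L; apply: (le_trans L).
  by rewrite le_eqVlt; apply/orP; left; apply/eqP; field; rewrite gt_eqF.
(* [(1 + z) (1 - z) <= 1 <= b (1 - z)], whatever the sign of [z]. *)
have b1 : 1 + z <= b.
  rewrite -(ler_pM2r z1'); apply: le_trans b_ge.
  by have := sqr_ge0 z; nra.
have qE : al1 / al0 * b = Nn / Dn.
  by rewrite bE; field; rewrite !gt_eqF.
split.
- by rewrite bE divr_gt0// mulr_gt0.
- rewrite -zE ler_pM2l//; apply/andP; split; first lra.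
  by rewrite mulrC -ler_pdivlMr//; lra.
- rewrite qE.
  have -> : (Nn / Dn - 1) / (1 + Nn / Dn + a ^+ (2 * n) * (1 - Nn / Dn)) =
      (Nn - Dn) / (Nn * (1 - a ^+ (2 * n)) + Dn * (1 + a ^+ (2 * n))).
    by field; rewrite S !gt_eqF// -S; lra.
  rewrite S /Nn /Dn; field.
  by rewrite !gt_eqF.
Qed.

End asymptotics.

(** * Limits of the real sequences *)

Section limits.
Context {R : realType}.

Lemma cvg_inv_odd : (2 * n%:R + 1 : R)^-1 @[n --> \oo] --> (0 : R).
Proof.
apply: (@squeeze_cvgr _ _ _ _ (fun=> 0) (@harmonic R)).
- near=> n; apply/andP; split; first by rewrite invr_ge0.
  have n0 : 0 <= n%:R :> R by [].
  by rewrite /harmonic /= lef_pV2 ?posrE -?natr1; lra.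
- exact: cvg_cst.
- exact: cvg_harmonic.
Unshelve. all: by end_near. Qed.

(** The factor [r] varies slowly and may tend to 0; it is kept apart from [g] for the case
    [alpha1 = alpha0], where the leading coefficient vanishes and a decay like [1 / (2n+1)]
    appears. *)
Lemma cvg_ratio_of_equiv (a K g0 : R) (u g r : nat -> R) :
  a != 0 -> K != 0 -> g0 != 0 ->
  (forall n, (0 < n)%N -> u n = K * a ^+ (2 * n) * (g n * r n)) ->
  g n @[n --> \oo] --> g0 -> r n / r n.+1 @[n --> \oo] --> (1 : R) ->
  u n / u n.+1 @[n --> \oo] --> a ^- 2.
Proof.
move=> a0 K0 g00 uE gl rl.
have gS : g n.+1 @[n --> \oo] --> g0 by rewrite (cvg_shiftS g).
have h : a ^- 2 * ((g n / g n.+1) * (r n / r n.+1)) @[n --> \oo] --> a ^- 2.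
  rewrite [X in _ --> X](_ : _ = a ^- 2 * ((g0 / g0) * 1)); last first.
    by rewrite divff// !mulr1.
  apply: cvgM; first exact: cvg_cst.
  by apply: cvgM => //; apply: cvgM => //; exact: cvgV.
apply: cvg_trans h; apply: near_eq_cvg; near=> n.
have n0 : (0 < n)%N by near: n; exact: nbhs_infty_gt.
rewrite !uE//.
have -> : a ^+ (2 * n.+1) = a ^+ (2 * n) * a ^+ 2.
  by rewrite -exprD; congr (_ ^+ _); rewrite mulnS addnC.
have X0 : a ^+ (2 * n) != 0 by rewrite expf_neq0.
rewrite !invfM; move: (g n.+1)^-1 (r n.+1)^-1 => g' r'.
by field; rewrite a0 K0 X0.
Unshelve. all: by end_near. Qed.

Section sequences.
Variables (a al0 al1 al2 : R) (p : nat -> R).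
Hypotheses (a01 : 0 < a < 1) (al00 : 0 < al0) (al10 : 0 < al1) (al20 : 0 <= al2).

Let k := al2 * a / al1.
Let q := al1 / al0.
Let b n := (al0 * (2 * al0 * a ^+ (2 * n) + (p n - al0) * (1 + a ^+ (2 * n)))) /
    (al1 * (2 * al0 * a ^+ (2 * n) - (p n - al0) * (1 - a ^+ (2 * n)))).
Let d n := (q * b n - 1) / ((1 + q * b n) + a ^+ (2 * n) * (1 - q * b n)).

Hypothesis Hp : forall n, (0 < n)%N ->
  [/\ 0 < b n, k - k ^+ 2 / (n%:R + 1) <= (2 * n%:R + 1) * (b n - 1) <= k &
      p n - al0 = 2 * al0 * a ^+ (2 * n) * d n].

Let a0 : 0 < a. Proof. by have /andP[] := a01. Qed.
Let q0 : 0 < q. Proof. exact: divr_gt0. Qed.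

Lemma cvg_scaled_ratio : (2 * n%:R + 1) * (b n - 1) @[n --> \oo] --> k.
Proof.
apply: (@squeeze_cvgr _ _ _ _ (fun n => k - k ^+ 2 * @harmonic R n) (fun=> k)).
- near=> n.
  have n0 : (0 < n)%N by near: n; exact: nbhs_infty_gt.
  by have [_ h _] := Hp n n0; rewrite /harmonic /= -natr1.
- rewrite -[X in _ --> X]subr0 -[X in _ --> _ - X](mulr0 (k ^+ 2)).
  apply: cvgB; first exact: cvg_cst.
  by apply: cvgM; [exact: cvg_cst|exact: cvg_harmonic].
- exact: cvg_cst.
Unshelve. all: by end_near. Qed.

Lemma cvg_b : b n @[n --> \oo] --> (1 : R).
Proof.
have -> : b = fun n => 1 + (2 * n%:R + 1) * (b n - 1) * (2 * n%:R + 1)^-1.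
  apply/funext => n.
  have m0 : 2 * n%:R + 1 != 0 :> R by rewrite -natrM natr1 pnatr_eq0.
  by rewrite mulrAC divff// mul1r addrC subrK.
rewrite -[X in _ --> X]addr0 -[X in _ --> _ + X](mulr0 k).
apply: cvgD; first exact: cvg_cst.
by apply: cvgM; [exact: cvg_scaled_ratio|exact: cvg_inv_odd].
Qed.

Lemma cvg_a2n : a ^+ (2 * n) @[n --> \oo] --> (0 : R).
Proof.
under eq_fun do rewrite exprM.
have /andP[_ a1] := a01.
apply: cvg_expr; rewrite ger0_norm ?sqr_ge0//.
by apply: exprn_ilt1 => //; exact: ltW.
Qed.

Lemma cvg_den : (1 + q * b n) + a ^+ (2 * n) * (1 - q * b n) @[n --> \oo] --> 1 + q.
Proof.
have qb : q * b n @[n --> \oo] --> q.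
  by rewrite -[X in _ --> X]mulr1; apply: cvgM; [exact: cvg_cst|exact: cvg_b].
rewrite -[X in _ --> X]addr0 -[X in _ --> _ + X](mul0r (1 - q)).
apply: cvgD; first by apply: cvgD => //; exact: cvg_cst.
apply: cvgM; first exact: cvg_a2n.
by apply: cvgB => //; exact: cvg_cst.
Qed.

Lemma cvg_d : d n @[n --> \oo] --> (q - 1) / (1 + q).
Proof.
have qb : q * b n @[n --> \oo] --> q.
  by rewrite -[X in _ --> X]mulr1; apply: cvgM; [exact: cvg_cst|exact: cvg_b].
apply: cvgM; first by apply: cvgB => //; exact: cvg_cst.
by apply: cvgV; [rewrite gt_eqF// addr_gt0|exact: cvg_den].
Qed.

Lemma cvg_p : p n @[n --> \oo] --> al0.
Proof.
have h : al0 + 2 * al0 * a ^+ (2 * n) * d n @[n --> \oo] --> al0.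
  rewrite [X in _ --> X](_ : _ = al0 + 2 * al0 * 0 * ((q - 1) / (1 + q))); last first.
    by rewrite mulr0 mul0r addr0.
  apply: cvgD; first exact: cvg_cst.
  apply: cvgM; last exact: cvg_d.
  by apply: cvgM; [exact: cvg_cst|exact: cvg_a2n].
apply: cvg_trans h; apply: near_eq_cvg; near=> n.
have n0 : (0 < n)%N by near: n; exact: nbhs_infty_gt.
by have [_ _ <-] := Hp n n0; rewrite addrC subrK.
Unshelve. all: by end_near. Qed.

Lemma cvg_normalized : (p n - al0) / (2 * a ^+ (2 * n) * al0) @[n --> \oo] -->
  (q - 1) / (1 + q).
Proof.
apply: cvg_trans cvg_d; apply: near_eq_cvg; near=> n.
have n0 : (0 < n)%N by near: n; exact: nbhs_infty_gt.
have [_ _ ->] := Hp n n0.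
have X0 : a ^+ (2 * n) != 0 by rewrite expf_neq0// gt_eqF.
by move: (d n) => D; field; rewrite X0 gt_eqF.
Unshelve. all: by end_near. Qed.

(** For [q <> 1], [d n] has a nonzero limit. For [q = 1] its numerator is [b n - 1], equivalent to
    [k / (2n+1)] when [k <> 0]; when [k = 0] the bounds force [b n = 1], hence [p n = al0] for all
    positive [n]. *)
Lemma cvg_ratio : ~ (forall n, (0 < n)%N -> p n = al0) ->
  (p n - al0) / (p n.+1 - al0) @[n --> \oo] --> a ^- 2.
Proof.
move=> hne.
have aN0 : a != 0 by rewrite gt_eqF.
have K0 : 2 * al0 != 0 by rewrite mulf_neq0// gt_eqF.
have [q1|q1] := eqVneq q 1; last first.
  apply: (@cvg_ratio_of_equiv a (2 * al0) ((q - 1) / (1 + q)) _ d (fun=> 1)) => //.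
  - by rewrite mulf_neq0 ?subr_eq0// invr_eq0 gt_eqF// addr_gt0.
  - by move=> n n0; have [_ _ ->] := Hp n n0; rewrite mulr1.
  - exact: cvg_d.
  - by under eq_fun do rewrite divr1; exact: cvg_cst.
have [k0|k0] := eqVneq k 0.
  exfalso; apply: hne => n n0; have [_ + pE] := Hp n n0.
  rewrite k0 expr0n/= mul0r subr0 => /andP[h1 h2].
  have m0 : 0 < 2 * n%:R + 1 :> R by have : 0 <= n%:R :> R by []; lra.
  have b1 : b n - 1 = 0.
    apply/eqP; rewrite eq_le -(pmulr_rle0 _ m0) h2 /=.
    by rewrite -(pmulr_rge0 _ m0).
  by apply/eqP; rewrite -subr_eq0 pE /d q1 mul1r b1 mul0r mulr0.
pose den n := (1 + q * b n) + a ^+ (2 * n) * (1 - q * b n).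
apply: (@cvg_ratio_of_equiv a (2 * al0) (k / (1 + q)) _
  (fun n => (2 * n%:R + 1) * (b n - 1) / den n) (fun n => (2 * n%:R + 1)^-1)) => //.
- by rewrite mulf_neq0// invr_eq0 gt_eqF// addr_gt0.
- move=> n n0; have [_ _ ->] := Hp n n0; congr (_ * _).
  have m0 : 2 * n%:R + 1 != 0 :> R by rewrite -natrM natr1 pnatr_eq0.
  have -> : d n = (b n - 1) / den n by rewrite /d /den q1 !mul1r.
  by move: (b n - 1) (den n)^-1 => x y; field.
- apply: cvgM; first exact: cvg_scaled_ratio.
  by apply: cvgV; [rewrite gt_eqF// addr_gt0|exact: cvg_den].
- have h : 1 + 2 * (2 * n%:R + 1 : R)^-1 @[n --> \oo] --> (1 : R).
    rewrite -[X in _ --> X]addr0 -[X in _ --> _ + X](mulr0 2).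
    apply: cvgD; first exact: cvg_cst.
    by apply: cvgM; [exact: cvg_cst|exact: cvg_inv_odd].
  apply: cvg_trans h; apply: near_eq_cvg; near=> n.
  have m0 : 2 * n%:R + 1 != 0 :> R by rewrite -natrM natr1 pnatr_eq0.
  by rewrite invrK -natr1; field.
Unshelve. all: by end_near. Qed.

End sequences.
End limits.

Lemma cvg_real_complex (R : realType) (u : nat -> R) (l : R) :
  u n @[n --> \oo] --> l -> (u n)%:C @[n --> \oo] --> (l%:C : R[i]^o).
Proof.
move=> ul; apply/(@cvgrPdist_lt R[i] (R[i]^o : normedModType R[i]) nat).
(* A positive complex number is real, so the tolerance is a positive real [x]. *)
move=> -[x y]; rewrite ltcE /= => /andP[/eqP -> x0].
have /cvgrPdist_lt/(_ _ x0) := ul.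
apply: filterS => n h; rewrite -rmorphB normc_def /= expr0n/= addr0 sqrtr_sqr.
by rewrite ltcR.
Qed.

Lemma cvg_eventually_real_complex (R : realType) (U : nat -> R[i]) (u : nat -> R)
    (l : R) : (forall n, (0 < n)%N -> U n = (u n)%:C) ->
  u n @[n --> \oo] --> l -> U n @[n --> \oo] --> (l%:C : R[i]^o).
Proof.
move=> Uu /cvg_real_complex ul; apply: cvg_trans ul; apply: near_eq_cvg.
near=> n; have n0 : (0 < n)%N by near: n; exact: nbhs_infty_gt.
by rewrite Uu.
Unshelve. all: by end_near. Qed.

Theorem proposition2p3 (R : realType) (a eps0 M N alpha0 alpha1 alpha2 : R)
    (C : nat -> R[i])
    (ha : 0 < a < 1) (heps0 : 0 < eps0) (hM : 0 < M) (hN : 0 <= N)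
    (halpha : in_mu eps0 M N alpha0 alpha1 alpha2)
    (hC : forall n : nat, (1 <= n)%N ->
      is_DNC (conductivity a alpha0 alpha1 alpha2) (expi n)
        (functional_of (fun t : R => C n * n%:R * expi n t)))
    (hseq : ~ exists nk : nat -> nat,
      [/\ forall k, (1 <= nk k)%N, forall k, (nk k < nk k.+1)%N &
          forall k, C (nk k) = alpha0%:C]) :
  [/\ C n @[n --> \oo] --> (alpha0%:C : R[i]^o),
      (C n - alpha0%:C) / (C n.+1 - alpha0%:C) @[n --> \oo]
        --> ((a ^- 2)%:C : R[i]^o),
      exists l : R[i]^o,
        [/\ (C n - alpha0%:C) / (2 * a%:C ^+ (2 * n) * alpha0%:C)
              @[n --> \oo] --> l,
            1 - l != 0 &
            alpha1%:C = alpha0%:C * ((l + 1) / (1 - l))] &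
      exists E : R[i]^o,
        (2 * n%:R + 1) *
          ((alpha0%:C * (2 * alpha0%:C * a%:C ^+ (2 * n) +
                           (C n - alpha0%:C) * (1 + a%:C ^+ (2 * n)))) /
           (alpha1%:C * (2 * alpha0%:C * a%:C ^+ (2 * n) -
                           (C n - alpha0%:C) * (1 - a%:C ^+ (2 * n))))
           - 1) @[n --> \oo] --> E /\
        (a * alpha2)%:C = alpha1%:C * E].
Proof.
have [/andP[e0 _] /andP[e1 _] /andP[al20 _]] := halpha.
have al00 := lt_le_trans heps0 e0; have al10 := lt_le_trans heps0 e1.
have /andP[a0 a1] := ha.
pose p n := complex.Re (C n).
have Cp n : (0 < n)%N -> C n = (p n)%:C.
  move=> n0.
  have [r [rE _]] :=
    conductivity_mode_bounds _ _ _ _ _ _ ha al00 al10 al20 n0 (hC n n0).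
  by rewrite /p rE.
pose k := alpha2 * a / alpha1; pose q := alpha1 / alpha0.
pose b n := (alpha0 * (2 * alpha0 * a ^+ (2 * n) + (p n - alpha0) * (1 + a ^+ (2 * n)))) /
  (alpha1 * (2 * alpha0 * a ^+ (2 * n) - (p n - alpha0) * (1 - a ^+ (2 * n)))).
have Hp n : (0 < n)%N ->
    [/\ 0 < b n, k - k ^+ 2 / (n%:R + 1) <= (2 * n%:R + 1) * (b n - 1) <= k &
      p n - alpha0 = 2 * alpha0 * a ^+ (2 * n) *
        ((q * b n - 1) / ((1 + q * b n) + a ^+ (2 * n) * (1 - q * b n)))].
  move=> n0; apply: ratio_bounds => //.
  have [r [rE hr]] :=
    conductivity_mode_bounds _ _ _ _ _ _ ha al00 al10 al20 n0 (hC n n0).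
  by rewrite /p rE.
have q0 : 0 < q by rewrite divr_gt0.
have E1 : 1 + q != 0 by rewrite gt_eqF// addr_gt0.
have hne : ~ (forall n, (0 < n)%N -> p n = alpha0).
  move=> pE; apply: hseq; exists (fun j => j.+1); split=> // j.
  by rewrite Cp// pE.
have rC := (rmorphD (real_complex R), rmorphN (real_complex R), rmorphM (real_complex R),
  fmorphV (real_complex R), rmorphXn (real_complex R), rmorph_nat (real_complex R),
  rmorph1 (real_complex R)).
split.
- apply: cvg_eventually_real_complex Cp _.
  exact: cvg_p a alpha0 alpha1 alpha2 p ha al00 al10 Hp.
- apply: (cvg_eventually_real_complex _ _
    (fun n => (p n - alpha0) / (p n.+1 - alpha0))).
    by move=> n n0; rewrite !Cp// !rC.
  exact: (cvg_ratio a alpha0 alpha1 alpha2 p ha al00 al10 Hp hne).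
(* The map [l -> (l + 1) / (1 - l)] is inverse to [q -> (q - 1) / (1 + q)], so that [D = q]. *)
- exists ((q - 1) / (1 + q))%:C; split.
  + apply: (cvg_eventually_real_complex _ _
      (fun n => (p n - alpha0) / (2 * a ^+ (2 * n) * alpha0))).
      by move=> n n0; rewrite Cp// !rC.
    exact: (cvg_normalized a alpha0 alpha1 alpha2 p ha al00 al10 Hp).
  + rewrite -(rmorph1 (real_complex R)) -rmorphB fmorph_eq0.
    rewrite (_ : _ - _ = 2 / (1 + q)); last by field.
    by rewrite mulf_neq0// invr_eq0.
  + rewrite -(rmorph1 (real_complex R)) -rmorphB -rmorphD -fmorphV -!rmorphM.
    congr (_%:C); rewrite (_ : 1 - _ = 2 / (1 + q)); last by field.
    have s0 : alpha0 + alpha1 != 0 by rewrite gt_eqF// addr_gt0.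
    by rewrite /q; field; rewrite s0 gt_eqF.
- exists k%:C; split.
  + apply: (cvg_eventually_real_complex _ _ (fun n => (2 * n%:R + 1) * (b n - 1))).
      by move=> n n0; rewrite Cp// /b !rC.
    exact: (cvg_scaled_ratio a alpha0 alpha1 alpha2 p Hp).
  + rewrite -rmorphM; congr (_%:C); rewrite /k; field.
    by rewrite gt_eqF.
Qed.
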